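(* For every $\eta>0$ there are constants $C,C',T_0>0$ depending only on $\eta$ such that the following holds. Let $n,T,d$ be positive integers with $T\ge T_0$ and $$d\ge C(\log T)(\log\log T)^{2+\eta}.$$ Then for any matrix $A\in\{0,1\}^{n\times T}$ each of whose columns has at most $d$ nonzero entries, $$\mathrm{disc}(A)\le C'\sqrt d .$$
   Context: For a matrix $A\in\{0,1\}^{n\times T}$, its discrepancy is $\mathrm{disc}(A):=\min_{\varepsilon\in\{-1,1\}^T}\|A\varepsilon\|_\infty$. $\log$ is the natural logarithm. *)

(* Defs.v *)
From HB Require Import structures.
From mathcomp Require Import all_boot all_order all_algebra.
From mathcomp Require Import all_classical all_reals all_analysis.
Set Implicit Arguments.
Unset Strict Implicit.
Unset Printing Implicit Defensive.
Import Order.TTheory GRing.Theory Num.Theory.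
Import numFieldNormedType.Exports.
Local Open Scope ring_scope.

Definition sign_vec (R : realType) (T : nat) (s : {ffun 'I_T -> bool}) :
    'cV[R]_T :=
  \col_j (-1) ^+ s j.

(* `|_| on matrices is the entrywise max norm, i.e. the sup norm on columns.
   The default value of the iterated minimum is itself one of the minimised
   values (the all-ones sign vector), so this is a genuine minimum. *)
Definition disc (R : realType) (n T : nat) (A : 'M[R]_(n, T)) : R :=
  \big[Num.min/`|A *m sign_vec R [ffun=> false]|]_(s : {ffun 'I_T -> bool})
    `|A *m sign_vec R s|.

(* Main.v *)
Require Import Defs.
From HB Require Import structures.
From mathcomp Require Import all_boot all_order all_algebra.
From mathcomp Require Import all_classical all_reals all_analysis.
From mathcomp Require Import ring lra zify.
Import Order.TTheory GRing.Theory Num.Theory.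
Import numFieldNormedType.Exports.
Local Open Scope ring_scope.

Set Implicit Arguments.
Unset Strict Implicit.
Unset Printing Implicit Defensive.

(** The colouring is reached from the fractional colouring 0 by freezing
    coordinates at -1 or 1, one at least per round.  Let V be the set of alive
    coordinates and m its cardinality.  A row with more than 20 d alive entries
    keeps its sum equal to 0; a row with at most sqrt d alive entries is left
    alone, since what remains alive in it cannot matter.  Any other row has a
    level k, its alive size being between 10 d / 2^k and 20 d / 2^k, and its
    sum must stay below a barrier B_k.  The gaps B_k - B_(k-1) have order
    sqrt (log T) + sqrt (d / 2^k) and there are O(log d) levels, so all barriers
    are O(sqrt d) as soon as sqrt (log T) * log d = O(sqrt d), which is what the
    lower bound on d provides ([ln_sqr_le]).

    A row that touches its barrier is blocked, and the point is to keep the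
    blocked rows below a small fraction of m at all times.  Row i has a danger
    G_i = mu 2^k exp (lam (gam r - B_k)) (exp (lam y) + exp (- lam y)), where y
    is its sum and r the sum of 1 - x_j^2 over the row; r is the remaining
    variance, and its decrease pays for the convexity of exp.  The load of a
    column is the sum of the dangers of its rows, and the potential is the sum
    of exp (load) + (1 - x_j^2) over alive columns.  A potential at most T^3
    bounds every load by 3 log T: the exponential is a union bound over columns,
    and the only place where log T enters.  A blocked row of level k has danger
    at least mu 2^k and 10 d / 2^k alive entries, so that counting the incidences
    of alive columns with rows leaves at most m / 20 rows blocked at their barrier.
    Similarly, at most m / 20 rows have more than 20 d alive entries.

    A point minimising the potential under these constraints freezes a new
    coordinate: otherwise the constraints allow a direction along which the
    potential strictly decreases to second order ([exists_good_direction]).  The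
    obstacle is that the d rows of a column may move together, which would make
    the square of the slope of its load too large.  The remedy is
    [spectral_cut]: a sum of squares of linear forms is dominated by a weighted
    square norm once the direction is orthogonal to a number of vectors bounded
    by the trace.  It is applied to the load slopes in two stages, in the space
    of rows and then in the space of columns; the trace of the first stage is
    controlled by the loads themselves.  All orthogonality constraints together
    number less than m, so that a nonzero direction survives.

    When V shrinks the levels of rows increase, and the widening of the barrier
    by one gap compensates the doubling of the weight mu 2^k
    ([level_danger_succ]), so the potential does not increase and the rounds go
    on until V is empty. *)

(** * Orthogonality to few vectors *)

Definition dot {R : realType} {I : finType} (u v : I -> R) : R :=
  \sum_i u i * v i.

Lemma exists_orthogonal {R : realType} {I : finType} (s : seq (I -> R)) :
  (size s < #|I|)%N ->
  exists2 v : I -> R, exists i, v i != 0 & all (fun u => dot u v == 0) s.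
Proof.
move=> ltsI.
pose M : 'M[R]_(#|I|, size s) :=
  \matrix_(a, b) nth (fun=> 0) s b (enum_val a).
have /rowV0Pn[w wM wN0] : kermx M != 0.
  rewrite -mxrank_eq0 mxrank_ker -lt0n subn_gt0.
  exact: leq_ltn_trans (rank_leq_col _) ltsI.
exists (fun i => w 0 (enum_rank i)).
  have /existsP[a wa] : [exists a, w 0 a != 0].
    apply: contraNT wN0; rewrite negb_exists => /forallP w0.
    by apply/eqP/rowP => a; rewrite mxE; apply/eqP; rewrite -[_ == _]negbK w0.
  by exists (enum_val a); rewrite enum_valK.
apply/(all_nthP (fun=> 0)) => b ltbs.
move/sub_kermxP: wM => /rowP /(_ (Ordinal ltbs)); rewrite !mxE => wM0.
rewrite /dot (reindex (@enum_val I predT)) /=; last exact: onW_bij (enum_val_bij _).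
apply/eqP; rewrite -[RHS]wM0; apply: eq_bigr => a _.
by rewrite enum_valK !mxE mulrC.
Qed.

(** Greedy deflation: a direction w violating the conclusion carries more than
    c of the weighted trace, and projecting all the forms off w removes that
    share.  Hence at most t / c directions are ever removed, and no eigenvector
    is needed. *)
Lemma spectral_cut {R : realType} {J I : finType} (q : J -> R) (D : I -> R)
    (a : J -> I -> R) (c t : R) :
  (forall j, 0 <= q j) -> (forall i, 0 < D i) -> 0 < c ->
  \sum_j q j * (\sum_i a j i ^+ 2 / D i) <= t ->
  exists2 s : seq (I -> R), (size s)%:R * c <= t &
    forall v, all (fun u => dot u v == 0) s ->
      \sum_j q j * dot (a j) v ^+ 2 <= c * \sum_i D i * v i ^+ 2.
Proof.
move=> q0 D0 c0.
have tr0 (b : J -> I -> R) : 0 <= \sum_j q j * (\sum_i b j i ^+ 2 / D i).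
  apply: sumr_ge0 => j _; apply: mulr_ge0 => //; apply: sumr_ge0 => i _.
  by apply: divr_ge0; [exact: sqr_ge0 | exact: ltW].
have [N ltN] : exists N : nat, t < c * N%:R.
  exists (Num.truncn (t / c)).+1.
  have [t0|t0] := leP 0 t; last by rewrite (lt_le_trans t0) // mulr_ge0 // ltW.
  by rewrite -ltr_pdivrMl // mulrC truncnS_gt.
elim: N a t ltN => [|N IH] a t ltN trt.
  by move: (le_lt_trans (le_trans (tr0 a) trt) ltN); rewrite mulr0 ltxx.
have [allv|] := pselect (forall v,
    \sum_j q j * dot (a j) v ^+ 2 <= c * \sum_i D i * v i ^+ 2).
  by exists [::] => [|v _]; [rewrite mul0r (le_trans (tr0 a)) | exact: allv].
move=> /existsNP[w /negP]; rewrite -ltNge.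
set n := \sum_i D i * w i ^+ 2 => ltw.
have n0 : 0 <= n.
  by apply: sumr_ge0 => i _; rewrite mulr_ge0 ?sqr_ge0 // ltW.
have {}n0 : 0 < n.
  rewrite lt0r n0 andbT; apply/eqP => n_eq0; move: ltw.
  suff dot0 j : dot (a j) w = 0.
    by rewrite n_eq0 mulr0 big1 ?ltxx // => j _; rewrite dot0 expr0n mulr0.
  apply: big1 => i _.
  move: n_eq0 => /psumr_eq0P => /(_ (fun i _ => mulr_ge0 (ltW (D0 i)) (sqr_ge0 (w i)))).
  move=> /(_ i isT)/eqP; rewrite mulf_eq0 gt_eqF //= sqrf_eq0 => /eqP ->.
  by rewrite mulr0.
(* the forms projected off w, for the scalar product with weights D *)
pose b j i := a j i - dot (a j) w / n * (D i * w i).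
have trb : \sum_j q j * (\sum_i b j i ^+ 2 / D i) <= t - c.
  have -> : \sum_j q j * (\sum_i b j i ^+ 2 / D i) =
      \sum_j q j * (\sum_i a j i ^+ 2 / D i) -
      (\sum_j q j * dot (a j) w ^+ 2) / n.
    rewrite mulr_suml -sumrB; apply: eq_bigr => j _.
    rewrite -mulrA -mulrBr; congr (_ * _).
    have -> : \sum_i b j i ^+ 2 / D i = \sum_i a j i ^+ 2 / D i
        - 2 * (dot (a j) w / n) * dot (a j) w + (dot (a j) w / n) ^+ 2 * n.
      set x := dot (a j) w / n; rewrite {1}/n {1}/dot !mulr_sumr -sumrB.
      rewrite -big_split /=; apply: eq_bigr => i _.
      by rewrite /b -/x; field; rewrite gt_eqF.
    by field; rewrite gt_eqF.
  by apply: lerB => //; rewrite ler_pdivlMr // ltW.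
have {}ltN : t - c < c * N%:R by move: ltN; rewrite -natr1; lra.
have [s szs sP] := IH b (t - c) ltN trb.
exists ((fun i => D i * w i) :: s) => [|v /= /andP[/eqP wv0 vs]].
  by rewrite /= -natr1; move: szs; lra.
suff bE j : dot (b j) v = dot (a j) v.
  by apply: le_trans (sP v vs); apply: ler_sum => j _; rewrite bE.
have -> : dot (b j) v = dot (a j) v - dot (a j) w / n * dot (fun i => D i * w i) v.
  rewrite {1 2 4}/dot mulr_sumr -sumrB; apply: eq_bigr => i _.
  by rewrite /b; ring.
by rewrite wv0 mulr0 subr0.
Qed.

(** * Second-order change of the potential *)

(** The constant 2 instead of the 1 / 2 of the Taylor expansion leaves a bound that
    follows from 1 - w <= exp (- w); only the existence of some constant matters
    below, and no derivative has to be computed. *)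
Lemma expR_le_quadratic {R : realType} (w : R) :
  `|w| <= 1 / 2 -> expR w <= 1 + w + 2 * w ^+ 2.
Proof.
rewrite ler_norml => /andP[_ w2].
have p0 : 0 < expR (- w) by exact: expR_gt0.
have e1 := expR_ge1Dx (- w).
have -> : expR w = (expR (- w))^-1 by rewrite expRN invrK.
rewrite -div1r ler_pdivrMr //.
have q0 : 0 <= 1 + w + 2 * w ^+ 2 by nra.
apply: (@le_trans _ _ ((1 + w + 2 * w ^+ 2) * (1 + - w))); last exact: ler_wpM2l.
nra.
Qed.

Lemma sqr_le {R : realDomainType} (u c : R) : `|u| <= c -> u ^+ 2 <= c ^+ 2.
Proof. by move=> uc; rewrite -real_normK ?num_real // lerXn2r ?nnegrE // (le_trans _ uc). Qed.

Lemma le_of_eq {R : realDomainType} (a b : R) : a = b -> a <= b.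
Proof. by move=> ->. Qed.

Lemma norm_comb_le {R : realDomainType} (a b c d k : R) :
  0 <= a -> 0 <= b -> `|c| <= k -> `|d| <= k -> `|a * c + b * d| <= k * (a + b).
Proof.
move=> a0 b0 ck dk; apply: le_trans (ler_normD _ _) _.
rewrite !normrM (ger0_norm a0) (ger0_norm b0) mulrC [b * _]mulrC mulrDr.
by apply: lerD; exact: ler_wpM2r.
Qed.

Lemma sign_minus_le2 {R : realFieldType} (b : bool) (g y : R) :
  `|y| <= 1 -> 0 <= g -> g <= 1 / 2 -> `|(-1) ^+ b - 2 * g * y| <= 2.
Proof.
rewrite !ler_norml => /andP[y1 y2] g0 g2.
by case: b => /=; apply/andP; split; nra.
Qed.

Lemma scale1_le {R : realFieldType} (a m : R) : a * (1 / 1600) <= m / 16000 -> a * 10 <= m.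
Proof. lra. Qed.

Lemma scale2_le {R : realFieldType} (a m : R) : a * 80 <= 4 * m -> a * 20 <= m.
Proof. lra. Qed.

Lemma scale3_le {R : realFieldType} (a m : R) : a * (1 / 20) <= m / 200 -> a * 10 <= m.
Proof. lra. Qed.

(** The four families of constraints on a direction: blocked rows and the three
    uses of [spectral_cut]. *)
Lemma codim_lt (z a b c m : nat) :
  (z * 10 <= m)%N -> (a * 10 <= m)%N -> (b * 20 <= m)%N -> (c * 10 <= m)%N ->
  (0 < m)%N -> (z + (a + (b + c)) < m)%N.
Proof. lia. Qed.

Lemma curvature_budget {R : realFieldType} (A B N Q : R) :
  A <= 1 / 1600 * (80 * Q) -> B <= 1 / 20 * Q -> 0 <= N -> 0 < Q ->
  4 * B - 9 / 10 * (Q - N) + 4 * A - N < 0.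
Proof. lra. Qed.

Lemma finite_bound {R : realType} {F : finType} (b : F -> R) :
  exists2 K : R, 0 < K & forall i, `|b i| <= K.
Proof.
exists (1 + \sum_i `|b i|) => [|i]; first by rewrite ltr_wpDr // sumr_ge0.
by rewrite (bigD1 i) //= addrCA lerDl addr_ge0 // sumr_ge0.
Qed.

Section Potential.
Variables (R : realType) (I J : finType) (inc : I -> J -> bool).
Variables (V : {set J}) (M : {set I}) (lam gam e : I -> R) (off : J -> R).

Definition row_sum (x : J -> R) (i : I) : R := \sum_(j | inc i j) x j.

Definition slack (x : J -> R) (i : I) : R := \sum_(j | inc i j) (1 - x j ^+ 2).

(** The exponential of a barrier function, for either sign of the row sum.  The
    slack of the row decreases to second order along every direction, which
    offsets the second-order growth coming from [row_sum]. *)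
Definition tail (x : J -> R) (i : I) (b : bool) : R :=
  e i * expR (lam i * (gam i * slack x i + (-1) ^+ b * row_sum x i)).

Definition danger (x : J -> R) (i : I) : R := \sum_b tail x i b.

Definition load (x : J -> R) (j : J) : R :=
  off j + \sum_(i in M | inc i j) danger x i.

Definition potential (x : J -> R) : R :=
  \sum_(j in V) (expR (load x j) + (1 - x j ^+ 2)).

(** The first-order and, with opposite sign, the second-order coefficient of the
    exponent of [tail] along v. *)
Definition drift (x v : J -> R) (i : I) (b : bool) : R :=
  lam i * \sum_(l | inc i l) ((-1) ^+ b - 2 * gam i * x l) * v l.

Definition decay (v : J -> R) (i : I) : R :=
  lam i * gam i * \sum_(l | inc i l) v l ^+ 2.

Lemma tail_move x v t i b :
  tail (fun j => x j + t * v j) i b =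
  tail x i b * expR (t * drift x v i b - t ^+ 2 * decay v i).
Proof.
rewrite /tail -mulrA -expRD; congr (_ * expR _).
rewrite /drift /decay -!mulrA !(mulrCA _ (lam i)) -mulrBr -mulrDr.
congr (_ * _); rewrite /slack /row_sum !mulr_sumr -big_split -sumrB -!big_split /=.
by apply: eq_bigr => l _; ring.
Qed.

(** Coefficients of t and of t^2 in an upper bound for the load along v; the
    constants 4 and 9 / 10 absorb the terms of higher order. *)
Definition slope (x v : J -> R) (j : J) : R :=
  \sum_(i in M | inc i j) \sum_b tail x i b * drift x v i b.

Definition bend (x v : J -> R) (j : J) : R :=
  \sum_(i in M | inc i j)
    \sum_b tail x i b * (4 * drift x v i b ^+ 2 - 9 / 10 * decay v i).

Definition curvature (x v : J -> R) : R :=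
  \sum_(j in V) expR (load x j) * (bend x v j + 4 * slope x v j ^+ 2)
  - \sum_(j in V) v j ^+ 2.

Hypothesis lam_ge0 : forall i, i \in M -> 0 <= lam i.
Hypothesis gam_ge0 : forall i, i \in M -> 0 <= gam i.
Hypothesis e_ge0 : forall i, i \in M -> 0 <= e i.

Lemma tail_ge0 x i b : i \in M -> 0 <= tail x i b.
Proof. by move=> iM; rewrite mulr_ge0 ?e_ge0 ?expR_ge0. Qed.

Lemma decay_ge0 v i : i \in M -> 0 <= decay v i.
Proof.
move=> iM; rewrite !mulr_ge0 ?lam_ge0 ?gam_ge0 //.
by apply: sumr_ge0 => l _; exact: sqr_ge0.
Qed.

(** The constant K only says how small t must be; it may depend on v. *)
Lemma load_move x v :
  exists2 K : R, 0 < K & forall (t : R) j, `|t| * K <= 1 ->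
    load (fun l => x l + t * v l) j <=
    load x j + (t * slope x v j + t ^+ 2 * bend x v j).
Proof.
have [K1 K1_gt0 K1P] := finite_bound (fun ib : I * bool => drift x v ib.1 ib.2).
have [K2 K2_gt0 K2P] := finite_bound (decay v).
exists (4 * (K1 + K2 + 10)); first by lra.
move=> t j tK; rewrite /load -addrA lerD2l /slope /bend /danger.
rewrite !mulr_sumr -!big_split /=; apply: ler_sum => i /andP[iM _].
rewrite !mulr_sumr -!big_split /=; apply: ler_sum => b _.
rewrite tail_move.
have -> : tail x i b + (t * (tail x i b * drift x v i b) +
   t ^+ 2 * (tail x i b * (4 * drift x v i b ^+ 2 - 9 / 10 * decay v i))) =
   tail x i b * (1 + t * drift x v i b +
     t ^+ 2 * (4 * drift x v i b ^+ 2 - 9 / 10 * decay v i)) by ring.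
apply: ler_wpM2l; first exact: tail_ge0.
have := K1P (i, b); have := K2P i; have := decay_ge0 v iM => /=.
move: (drift _ _ _ _) (decay _ _) => a d d0.
rewrite (ger0_norm d0) => dK aK.
have t0 : 0 <= `|t| by [].
have ta : `|t * a| <= 1 / 4.
  rewrite normrM; apply: (@le_trans _ _ (`|t| * K1)); first exact: ler_wpM2l.
  nra.
have t1 : `|t| <= 1 / 40 by nra.
have td : `|t| * d <= 1 / 4 by nra.
have t2 : t ^+ 2 = `|t| * `|t| by rewrite -expr2 -normrX ger0_norm ?sqr_ge0.
have t2d : 0 <= t ^+ 2 * d <= 1 / 160.
  by rewrite mulr_ge0 ?sqr_ge0 //= t2 -mulrA; nra.
apply: le_trans (expR_le_quadratic _) _.
  rewrite ler_norml; move: ta; rewrite ler_norml; lra.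
have : 2 * (t * a - t ^+ 2 * d) ^+ 2 <=
       4 * (t * a) ^+ 2 + 4 * (t ^+ 2 * d) ^+ 2.
  by have := sqr_ge0 (t * a + t ^+ 2 * d); lra.
have : (t ^+ 2 * d) ^+ 2 <= t ^+ 2 * d / 160.
  by move: t2d; move: (t ^+ 2 * d) => y; nra.
have := sqr_ge0 t; lra.
Qed.

Lemma potential_move x v :
  exists2 K : R, 0 < K & exists b Y : R, forall t : R, `|t| * K <= 1 ->
    potential (fun l => x l + t * v l) <=
    potential x + t * b + t ^+ 2 * (curvature x v + t ^+ 2 * Y).
Proof.
have [K0 K0_gt0 K0P] := load_move x v.
have [K1 K1_gt0 K1P] := finite_bound (slope x v).
have [K2 K2_gt0 K2P] := finite_bound (bend x v).
exists (K0 + 4 * (K1 + K2 + 1)); first by lra.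
exists (\sum_(j in V) (expR (load x j) * slope x v j - 2 * x j * v j)).
exists (\sum_(j in V) 4 * expR (load x j) * bend x v j ^+ 2).
move=> t tK.
rewrite /curvature /potential -sumrB [t ^+ 2 * \sum_(_ in V) _]mulr_sumr.
rewrite -big_split /= !mulr_sumr -!big_split /=; apply: ler_sum => j _.
have t0 : 0 <= `|t| by [].
have tK0 : `|t| * K0 <= 1 by nra.
have := K1P j; have := K2P j; have := K0P t j tK0; rewrite -ler_expR expRD.
have := expR_ge0 (load x j).
move: (expR (load x j)) (slope _ _ _) (bend _ _ _) => q f g q0 le1 gK fK.
have tf : `|t * f| <= 1 / 4.
  rewrite normrM; apply: (@le_trans _ _ (`|t| * K1)); first exact: ler_wpM2l.
  nra.
have tg : `|t ^+ 2 * g| <= 1 / 4.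
  have t1 : `|t| <= 1 by nra.
  rewrite normrM normrX; apply: (@le_trans _ _ (`|t| * K2)); last by nra.
  by apply: ler_pM => //; rewrite expr2 ler_piMl.
have le2 : expR (t * f + t ^+ 2 * g) <=
    1 + (t * f + t ^+ 2 * g) + 4 * (t * f) ^+ 2 + 4 * (t ^+ 2 * g) ^+ 2.
  apply: le_trans (expR_le_quadratic _) _.
    by move: tf tg; rewrite !ler_norml; lra.
  by have := sqr_ge0 (t * f - t ^+ 2 * g); lra.
have := ler_wpM2l q0 le2; move: le1; lra.
Qed.

(** The linear terms cancel in the sum of the two opposite moves, so that one of
    them decreases the potential whatever its gradient is. *)
Lemma potential_drop x v : curvature x v < 0 ->
  exists2 t0 : R, 0 < t0 & forall t : R, 0 < t <= t0 ->
    potential (fun l => x l + t * v l) + potential (fun l => x l + - t * v l)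
    < 2 * potential x.
Proof.
move=> X0; have [K K0 [b [Y P]]] := potential_move x v.
set X := curvature x v in X0 P.
exists (Num.min K^-1 (Num.min 1 (- X / (2 * (`|Y| + 1))))).
  by rewrite !lt_min invr_gt0 K0 ltr01 /= divr_gt0 ?oppr_gt0 // mulr_gt0 ?ltr_wpDl.
move=> t /andP[t0]; rewrite !le_min => /and3P[tK t1 tX].
have {}tK : t * K <= 1 by rewrite -ler_pdivlMr // div1r.
have := P t; rewrite gtr0_norm // => /(_ tK).
have := P (- t); rewrite normrN gtr0_norm // => /(_ tK).
suff : t ^+ 2 * (X + t ^+ 2 * Y) < 0 by rewrite sqrrN; lra.
rewrite pmulr_rlt0 ?exprn_gt0 //.
have {}tX : t * (2 * (`|Y| + 1)) <= - X.
  by move: tX; rewrite ler_pdivlMr // mulr_gt0 // ltr_wpDl.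
have : t ^+ 2 * Y <= t * (`|Y| + 1).
  apply: (@le_trans _ _ (t ^+ 2 * (`|Y| + 1))).
    by apply: ler_wpM2l; [exact: sqr_ge0 | rewrite (le_trans (ler_norm Y)) ?lerDl].
  by apply: ler_wpM2r; [rewrite addr_ge0 | rewrite expr2 ler_piMl // ltW].
lra.
Qed.

(** * A direction of negative curvature *)

Definition alive_weight (x : J -> R) (i : I) : R :=
  \sum_(j in V | inc i j) expR (load x j).

Lemma sum_alive_weight x (F : I -> R) :
  \sum_(j in V) expR (load x j) * \sum_(i in M | inc i j) F i =
  \sum_(i in M) alive_weight x i * F i.
Proof.
under eq_bigr do rewrite mulr_sumr.
rewrite (exchange_big_dep (mem M)) /=; last by move=> j i _ /andP[].
by apply: eq_bigr => i iM; rewrite /alive_weight mulr_suml; apply: eq_bigl => j; rewrite iM.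
Qed.

(** All quadratic forms are compared with the diagonal form of weights
    D l = 1 + sum of lam gam G W over the rows through l, which is what the decay
    of slacks and the term 1 - x_l^2 contribute to the curvature.  The squares
    of the drifts cost one cut.  For the load slopes, sum_j q_j (sum_i xi_i)^2
    is first compared with sum_i Th_i xi_i^2, where Th_i = gam W / (lam G) is
    chosen so that the next comparison, with D, has trace O(m); the first trace
    is then exactly the sum of lam G / gam that the hypothesis bounds. *)
Lemma exists_good_direction x (Z : {set I}) :
  (forall l, `|x l| <= 1) ->
  {in M, forall i, 0 < lam i} -> {in M, forall i, 0 < gam i} ->
  {in M, forall i, 0 < e i} ->
  {in M, forall i, gam i <= 1 / 2} ->
  {in M, forall i, lam i <= gam i / 800} ->
  {in M, forall i, exists2 j, j \in V & inc i j} ->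
  (0 < #|V|)%N ->
  \sum_(i in M) lam i * danger x i / gam i <= #|V|%:R / 16000 ->
  (#|Z| * 10 <= #|V|)%N ->
  exists v : J -> R, [/\ exists j, v j != 0, forall j, j \notin V -> v j = 0,
    {in Z, forall i, row_sum v i = 0} & curvature x v < 0].
Proof.
move=> x1 lam0 gam0 e0 gam2 lamgam alive V0 sumG ZV.
set m : R := #|V|%:R in sumG.
pose q j := expR (load x j); pose W := alive_weight x; pose G := danger x.
have q0 j : 0 < q j by exact: expR_gt0.
have t0 i b : i \in M -> 0 < tail x i b by move=> iM; rewrite mulr_gt0 ?expR_gt0 ?e0.
have GE i : G i = tail x i false + tail x i true by rewrite /G /danger big_bool addrC.
have G0 i : i \in M -> 0 < G i by move=> iM; rewrite GE addr_gt0 ?t0.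
have W_ge0 i : 0 <= W i by apply: sumr_ge0 => j _; exact: expR_ge0.
have W0 i : i \in M -> 0 < W i.
  move=> iM; have [j jV ij] := alive i iM.
  rewrite /W /alive_weight (bigD1 j) /=; last by rewrite jV.
  by rewrite ltr_pwDl ?expR_gt0 // sumr_ge0 // => k _; exact: expR_ge0.
pose D l := 1 + \sum_(i in M | inc i l) lam i * gam i * (G i * W i).
have Dsum0 l : 0 <= \sum_(i in M | inc i l) lam i * gam i * (G i * W i).
  apply: sumr_ge0 => i /andP[iM _].
  by rewrite !mulr_ge0 // ltW ?lam0 ?gam0 ?G0.
have D0 l : 0 < D l by rewrite ltr_pwDl.
pose Th i := if i \in M then gam i * W i / (lam i * G i) else 1.
have Th0 i : 0 < Th i.
  rewrite /Th; case: ifP => // iM.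
  by rewrite divr_gt0 // mulr_gt0 ?lam0 ?gam0 ?G0 ?W0.
pose co i l (b : bool) := lam i * ((-1) ^+ b - 2 * gam i * x l).
have co2 i l b : i \in M -> `|co i l b| <= 2 * lam i.
  move=> iM; rewrite /co normrM gtr0_norm ?lam0 // mulrC; apply: ler_wpM2r.
    by rewrite ltW ?lam0.
  exact: sign_minus_le2 (x1 l) (ltW (gam0 i iM)) (gam2 i iM).
pose h (ib : I * bool) l :=
  if [&& ib.1 \in M, inc ib.1 l & l \in V] then co ib.1 l ib.2 else 0.
pose f i l := \sum_b tail x i b * h (i, b) l.
have h2 ib l : h ib l ^+ 2 <= if (ib.1 \in M) && inc ib.1 l && (l \in V)
    then 4 * lam ib.1 ^+ 2 else 0.
  rewrite /h -andbA; case: ifP => [/and3P[iM _ _]|_]; last by rewrite expr0n.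
  apply: le_trans (sqr_le (co2 ib.1 l ib.2 iM)) _.
  by rewrite exprMn -natrX.
have f2 i l : f i l ^+ 2 <= if (i \in M) && inc i l && (l \in V)
    then 4 * (lam i * G i) ^+ 2 else 0.
  rewrite /f /h /= -andbA; case: ifP => [/and3P[iM _ _]|_]; last first.
    by under eq_bigr do rewrite mulr0; rewrite big1_eq expr0n.
  rewrite big_bool GE /=.
  apply: (@le_trans _ _ ((2 * lam i * (tail x i true + tail x i false)) ^+ 2)).
    exact: sqr_le (norm_comb_le (ltW (t0 i true iM)) (ltW (t0 i false iM))
      (co2 i l true iM) (co2 i l false iM)).
  by apply: le_of_eq; ring.
(* first cut, in the space of rows: load slopes against the weights Th *)
pose a1 j i : R := ((i \in M) && inc i j)%:R.
pose q1 j := if j \in V then q j else 0.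
have tr1 : \sum_j q1 j * (\sum_i a1 j i ^+ 2 / Th i) <= m / 16000.
  have -> : \sum_j q1 j * (\sum_i a1 j i ^+ 2 / Th i) =
      \sum_(j in V) q j * (\sum_(i in M | inc i j) (Th i)^-1).
    rewrite [RHS]big_mkcond /=; apply: eq_bigr => j _; rewrite /q1.
    case: ifP => _; last by rewrite mul0r.
    rewrite [in RHS]big_mkcond /=; congr (_ * _); apply: eq_bigr => i _.
    by rewrite /a1; case: ifP => _; rewrite ?expr1n ?mul1r ?expr0n ?mul0r.
  rewrite sum_alive_weight; apply: le_trans sumG; apply: ler_sum => i iM.
  rewrite /Th iM invf_div -/(G i) -/(W i); have := W0 i iM; have := gam0 i iM.
  move: (gam i) (W i) (G i) (lam i) => g w k l g0 w0.
  by apply: le_of_eq; field; rewrite !gt_eqF.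
have [s1 sz1 s1P] : exists2 s : seq (I -> R), (size s)%:R * (1 / 1600) <= m / 16000 &
    forall v, all (fun u => dot u v == 0) s ->
      \sum_j q1 j * dot (a1 j) v ^+ 2 <= 1 / 1600 * \sum_i Th i * v i ^+ 2.
  apply: spectral_cut tr1 => [j||]; [|exact: Th0|by rewrite divr_gt0 ?ltr01 ?ltr0n].
  by rewrite /q1; case: ifP => _; [exact: ltW (q0 j)|].
(* each alive column contributes at most 4 to a trace relative to D *)
have trD (F : I -> R) : (forall i, i \in M -> F i <= 4 * (lam i * gam i * (G i * W i))) ->
    \sum_i \sum_l (if (i \in M) && inc i l && (l \in V) then F i else 0) / D l <= 4 * m.
  move=> FP; rewrite exchange_big /= /m -sum1_card natr_sum mulr_sumr [leRHS]big_mkcond.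
  apply: ler_sum => l _; rewrite -mulr_suml; case: (l \in V) => /=; last first.
    by under eq_bigr do rewrite andbF; rewrite big1_eq mul0r.
  rewrite mulr1 ler_pdivrMr // -big_mkcondr /=.
  under eq_bigl do rewrite andbT.
  apply: (@le_trans _ _ (4 * (\sum_(i in M | inc i l) lam i * gam i * (G i * W i)))).
    by rewrite mulr_sumr; apply: ler_sum => i /andP[iM _]; exact: FP.
  by rewrite ler_wpM2l // lerDr.
(* second cut, in the space of columns: the row slopes against D *)
pose q2 i := if i \in M then Th i else 0.
have tr2 : \sum_i q2 i * (\sum_l f i l ^+ 2 / D l) <= 4 * m.
  apply: le_trans (trD (fun i => Th i * (4 * (lam i * G i) ^+ 2)) _).
    apply: ler_sum => i _; rewrite mulr_sumr; apply: ler_sum => l _.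
    rewrite mulrA ler_pM2r; last by rewrite invr_gt0; exact: D0.
    rewrite /q2.
    have := f2 i l; case: (i \in M) => /=; last by rewrite mul0r.
    case: ifP => _ le; first by apply: ler_wpM2l le; exact: ltW (Th0 i).
    by rewrite pmulr_rle0.
  move=> i iM; rewrite /Th iM.
  have := lam0 i iM; have := G0 i iM => l0 g0.
  by apply: le_of_eq; field; rewrite !gt_eqF.
have [s2 sz2 s2P] : exists2 s : seq (J -> R), (size s)%:R * 80 <= 4 * m &
    forall v, all (fun u => dot u v == 0) s ->
      \sum_i q2 i * dot (f i) v ^+ 2 <= 80 * \sum_l D l * v l ^+ 2.
  apply: spectral_cut tr2 => [i||]; [|exact: D0|by rewrite ltr0n].
  by rewrite /q2; case: ifP => _; [exact: ltW (Th0 i)|].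
(* third cut: the squares of the drifts against D *)
pose q3 (ib : I * bool) := if ib.1 \in M then W ib.1 * tail x ib.1 ib.2 else 0.
have tr3 : \sum_ib q3 ib * (\sum_l h ib l ^+ 2 / D l) <= m / 200.
  rewrite -(pair_bigA _ (fun i b => q3 (i, b) * (\sum_l h (i, b) l ^+ 2 / D l))) /=.
  have -> : m / 200 = 1 / 800 * (4 * m) by field.
  apply: (@le_trans _ _ (1 / 800 * \sum_i \sum_l (if (i \in M) && inc i l && (l \in V)
      then 800 * (4 * lam i ^+ 2 * (G i * W i)) else 0) / D l)).
    rewrite mulr_sumr; apply: ler_sum => i _; rewrite mulr_sumr.
    under eq_bigr do rewrite mulr_sumr.
    rewrite exchange_big /=; apply: ler_sum => l _.
    under eq_bigr do rewrite mulrA.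
    rewrite -mulr_suml [leRHS]mulrA ler_pM2r; last by rewrite invr_gt0; exact: D0.
    rewrite big_bool /q3 /=.
    have := h2 (i, true) l; have := h2 (i, false) l => /=.
    case: ifP => [/andP[/andP[iM _] _]|_ hf ht]; last first.
      have {hf}-> : h (i, false) l ^+ 2 = 0 by apply/le_anti; rewrite hf sqr_ge0.
      have {ht}-> : h (i, true) l ^+ 2 = 0 by apply/le_anti; rewrite ht sqr_ge0.
      by rewrite !mulr0 addr0.
    rewrite iM GE => hf ht.
    have p1 : 0 <= W i * tail x i true by apply: mulr_ge0 (W_ge0 i) (ltW (t0 _ _ iM)).
    have p2 : 0 <= W i * tail x i false by apply: mulr_ge0 (W_ge0 i) (ltW (t0 _ _ iM)).
    apply: le_trans (lerD (ler_wpM2l p1 ht) (ler_wpM2l p2 hf)) _.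
    by apply: le_of_eq => /=; field.
  apply: ler_wpM2l; first by rewrite divr_ge0 ?ler01 ?ler0n.
  apply: trD => i iM; rewrite !mulrA ler_pM2r; last exact: W0.
  rewrite ler_pM2r; last exact: G0.
  have le := ler_wpM2l (ler0n R 3200) (ler_wpM2l (ltW (lam0 i iM)) (lamgam i iM)).
  by apply: le_trans (le_trans (le_of_eq _) le) (le_of_eq _); field.
have [s3 sz3 s3P] : exists2 s : seq (J -> R), (size s)%:R * (1 / 20) <= m / 200 &
    forall v, all (fun u => dot u v == 0) s ->
      \sum_ib q3 ib * dot (h ib) v ^+ 2 <= 1 / 20 * \sum_l D l * v l ^+ 2.
  apply: spectral_cut tr3 => [ib||]; [|exact: D0|by rewrite divr_gt0 ?ltr01 ?ltr0n].
  rewrite /q3; case: ifP => // iM; apply: mulr_ge0; first exact: W_ge0.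
  exact: ltW (t0 _ _ iM).
(* a direction supported on V, blind to Z, and orthogonal to the three cuts;
   the first cut lives on rows and is pulled back to columns through f *)
pose S := [seq (fun l => (l == j)%:R : R) | j <- enum (~: V)] ++
  [seq (fun l => (inc i l)%:R : R) | i <- enum Z] ++
  [seq (fun l => \sum_i u i * f i l) | u <- s1] ++ s2 ++ s3.
have szS : (size S < #|J|)%N.
  rewrite /S !size_cat !size_map -!cardE -(cardsC V) addnC ltn_add2r.
  have n1 : (size s1 * 10 <= #|V|)%N by rewrite -(ler_nat R) natrM -/m; exact: scale1_le sz1.
  have n2 : (size s2 * 20 <= #|V|)%N by rewrite -(ler_nat R) natrM -/m; exact: scale2_le sz2.
  have n3 : (size s3 * 10 <= #|V|)%N by rewrite -(ler_nat R) natrM -/m; exact: scale3_le sz3.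
  exact: codim_lt.
have [v vN0] := exists_orthogonal szS.
rewrite !all_cat !all_map => /and5P[/allP vV /allP vZ v1 v2 v3].
have {}vV j : j \notin V -> v j = 0.
  move=> jV; have /vV /= /eqP : j \in enum (~: V) by rewrite mem_enum inE.
  rewrite /dot (bigD1 j) //= eqxx mul1r big1 ?addr0 // => l /negbTE ->.
  by rewrite mul0r.
exists v; split => //.
  move=> i; rewrite -mem_enum => /vZ /= /eqP <-; rewrite /row_sum /dot big_mkcond /=.
  by apply: eq_bigr => l _; case: ifP; rewrite ?mul1r ?mul0r.
have dotif (P : pred J) (u : J -> R) :
    dot (fun l => if P l && (l \in V) then u l else 0) v = \sum_(l | P l) u l * v l.
  rewrite /dot [RHS]big_mkcond; apply: eq_bigr => l _; case: (P l) => /=; last by rewrite mul0r.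
  by case: ifP => // /negbT /vV ->; rewrite !mulr0.
have hE i b : i \in M -> dot (h (i, b)) v = drift x v i b.
  move=> iM; rewrite /h /= iM /= dotif /drift mulr_sumr.
  by apply: eq_bigr => l _; rewrite mulrA.
have fE i : i \in M -> dot (f i) v = \sum_b tail x i b * drift x v i b.
  move=> iM; rewrite /dot /f; under eq_bigr do rewrite mulr_suml.
  rewrite exchange_big /=; apply: eq_bigr => b _; rewrite -hE // /dot mulr_sumr.
  by apply: eq_bigr => l _; rewrite mulrA.
pose xi i := dot (f i) v.
have {}v1 : all (fun u => dot u xi == 0) s1.
  apply: sub_all v1 => u /= /eqP <-; apply/eqP; rewrite /dot /xi /dot.
  under [RHS]eq_bigr do rewrite mulr_suml.
  rewrite [RHS]exchange_big /=; apply: eq_bigr => i _; rewrite mulr_sumr.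
  by apply: eq_bigr => l _; rewrite mulrA.
set Q := \sum_l D l * v l ^+ 2 in s2P s3P.
have F1 : \sum_(j in V) q j * slope x v j ^+ 2 <= 1 / 1600 * (80 * \sum_l D l * v l ^+ 2).
  apply: (@le_trans _ _ (1 / 1600 * \sum_i Th i * xi i ^+ 2)).
    apply: le_trans (s1P _ v1); rewrite big_mkcond /=; apply: ler_sum => j _.
    rewrite /q1; case: ifP => _; last by rewrite mul0r.
    have -> : slope x v j = dot (a1 j) xi; last by [].
    rewrite /slope /dot big_mkcond; apply: eq_bigr => i _; rewrite /a1.
    by case: ifP => [/andP[iM _]|_]; rewrite ?mul1r ?mul0r // /xi fE.
  apply: ler_wpM2l; first by rewrite divr_ge0 ?ler01 ?ler0n.
  apply: le_trans (s2P _ v2); apply: ler_sum => i _.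
  rewrite /q2 /xi; case: ifP => // iM.
  have -> : dot (f i) v = 0; last by rewrite expr0n mulr0 mul0r.
  apply: big1 => l _; rewrite /f big1 ?mul0r // => b _.
  by rewrite /h /= iM mulr0.
have F2 : \sum_(i in M) W i * (\sum_b tail x i b * drift x v i b ^+ 2) <= 1 / 20 * Q.
  apply: le_trans (s3P _ v3).
  rewrite -(pair_bigA _ (fun i b => q3 (i, b) * dot (h (i, b)) v ^+ 2)) /=.
  rewrite big_mkcond /=; apply: ler_sum => i _; rewrite /q3 /=.
  case: ifP => iM; last by rewrite big1 // => b _; rewrite mul0r.
  rewrite mulr_sumr; apply: ler_sum => b _.
  by rewrite hE // mulrA.
have F3 : \sum_(i in M) W i * (G i * decay v i) = Q - \sum_(j in V) v j ^+ 2.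
  rewrite /Q [X in _ - X]big_mkcond -sumrB.
  transitivity (\sum_l (\sum_(i in M | inc i l) lam i * gam i * (G i * W i)) * v l ^+ 2).
    under [RHS]eq_bigr do rewrite mulr_suml.
    rewrite (exchange_big_dep (mem M)) /=; last by move=> l i _ /andP[].
    apply: eq_bigr => i iM; under [RHS]eq_bigl do rewrite iM /=.
    by rewrite -[RHS]mulr_sumr /decay; ring.
  apply: eq_bigr => l _; rewrite /D mulrDl mul1r.
  by case: ifP => [_|/negbT /vV ->]; rewrite ?expr0n ?mulr0 ?addr0 ?subr0 //; ring.
have Q0 : 0 < Q.
  have [l vl] := vN0; rewrite /Q (bigD1 l) //= ltr_pwDl //.
    by rewrite mulr_gt0 ?D0 // exprn_even_gt0.
  by apply: sumr_ge0 => k _; rewrite mulr_ge0 ?sqr_ge0 //; exact: ltW (D0 k).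
have bendE : \sum_(j in V) q j * bend x v j =
    4 * (\sum_(i in M) W i * (\sum_b tail x i b * drift x v i b ^+ 2))
    - 9 / 10 * \sum_(i in M) W i * (G i * decay v i).
  rewrite /bend sum_alive_weight !mulr_sumr -sumrB; apply: eq_bigr => i iM.
  rewrite GE !big_bool /= -/(W i); ring.
rewrite /curvature; under eq_bigr do rewrite mulrDr mulrCA.
rewrite big_split /= -mulr_sumr bendE F3.
have N0 : 0 <= \sum_(j in V) v j ^+ 2 by apply: sumr_ge0 => j _; exact: sqr_ge0.
exact: curvature_budget F1 F2 N0 Q0.
Qed.

End Potential.

(** * Reaching a new face of the cube *)

Section Minimizer.
Variables (R : realType) (n : nat).
Implicit Types (x : 'I_n -> R) (f g : ('I_n -> R) -> R).

(** Continuity for the topology of row vectors, in which cubes are compact. *)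
Definition row_continuous f := continuous (fun y : 'rV[R]_n => f (y 0)).

Lemma row_continuous_sum (F : finType) (P : pred F) (f : F -> ('I_n -> R) -> R) :
  (forall i, P i -> row_continuous (f i)) ->
  row_continuous (fun x => \sum_(i | P i) f i x).
Proof.
move=> cf; apply: (@continuous_big _ _ +%R) => [|i /cf //].
exact: add_continuous.
Qed.

Lemma row_continuous_coord j : row_continuous (fun x => x j).
Proof. exact: coord_continuous. Qed.

Lemma row_continuous_cst (a : R) : row_continuous (fun=> a).
Proof. exact: cst_continuous. Qed.

Lemma row_continuousD f g :
  row_continuous f -> row_continuous g -> row_continuous (fun x => f x + g x).
Proof. by move=> cf cg y; exact: (cvgD (cf y) (cg y)). Qed.

Lemma row_continuousB f g :
  row_continuous f -> row_continuous g -> row_continuous (fun x => f x - g x).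
Proof. by move=> cf cg y; exact: (cvgB (cf y) (cg y)). Qed.

Lemma row_continuousM f g :
  row_continuous f -> row_continuous g -> row_continuous (fun x => f x * g x).
Proof. by move=> cf cg y; exact: (cvgM (cf y) (cg y)). Qed.

Lemma row_continuous_expR f :
  row_continuous f -> row_continuous (fun x => expR (f x)).
Proof. by move=> cf y; apply: (continuous_comp (cf y)); exact: continuous_expR. Qed.

Lemma exists_minimizer (S : set ('I_n -> R)) f x0 (F : finType)
    (g : F -> ('I_n -> R) -> R) (c : F -> R) :
  row_continuous f -> (forall i, row_continuous (g i)) ->
  (forall x, S x <-> (forall j, `|x j| <= 1) /\ forall i, g i x <= c i) ->
  S x0 -> exists2 x, S x & forall y, S y -> f x <= f y.
Proof.
move=> cf cg SP Sx0.
pose A : set 'rV[R]_n := [set y | S (y 0)]%classic.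
have rowK (x : 'I_n -> R) : (\row_j x j) 0 = x by apply/funext => j; rewrite mxE.
have cA : compact A.
  have -> : A = ([set y : 'rV[R]_n | forall j, `[-1, 1] (y 0 j)] `&`
      \bigcap_(i in [set: F]) (fun y : 'rV[R]_n => g i (y 0)) @^-1` [set z | z <= c i])%classic.
    apply/seteqP; split => y /=.
      move=> /SP[y1 yc]; split => [j|i _ /=]; last exact: yc.
      by rewrite in_itv /= -ler_norml.
    move=> [y1 yc]; apply/SP; split => [j|i]; last exact: yc.
    by have := y1 j; rewrite /= in_itv /= -ler_norml.
  apply: compact_closedI.
    apply: (@rV_compact R n (fun=> `[-1, 1]%classic)) => j; exact: segment_compact.
  apply: closed_bigI => i _. apply: (@preimage_closed _ _ (fun y : 'rV[R]_n => g i (y 0)) [set z | z <= c i]%classic); last exact: closed_le.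
  by move=> y _; exact: cg.
have A0 : (A !=set0)%classic by exists (\row_j x0 j); rewrite /A /= rowK.
have [y] := EVT_min_rV A0 cA (continuous_subspaceT cf).
rewrite inE => Ay ymin; exists (y 0) => // x Sx.
by have := ymin (\row_j x j); rewrite rowK inE /A /= rowK; exact.
Qed.

End Minimizer.

Lemma exists_small_step {R : realType} {F : finType} (p w b : F -> R) :
  (forall i, p i < b i) ->
  exists2 t1 : R, 0 < t1 & forall t i, 0 <= t <= t1 -> p i + t * w i <= b i.
Proof.
move=> pb; have [K K0 KP] := finite_bound (fun i => w i / (b i - p i)).
exists K^-1 => [|t i /andP[t0 tK]]; first by rewrite invr_gt0.
have bp : 0 < b i - p i by rewrite subr_gt0.
have := le_trans (ler_norm _) (KP i); rewrite ler_pdivrMr // => wK.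
have {}tK : t * K <= 1 by rewrite -ler_pdivlMr // div1r.
have := ler_wpM2l t0 wK; have := ler_wpM2r (ltW bp) tK; lra.
Qed.

Section Face.
Variables (R : realType) (I : finType) (n : nat) (inc : I -> 'I_n -> bool).
Variables (V : {set 'I_n}) (M : {set I}) (lam gam e : I -> R) (off : 'I_n -> R).

Let pot := potential inc V M lam gam e off.

Lemma row_continuous_row_sum i : row_continuous (fun x : 'I_n -> R => row_sum inc x i).
Proof. by apply: row_continuous_sum => j _; exact: row_continuous_coord. Qed.

Lemma row_continuous_potential : row_continuous pot.
Proof.
have sq k : row_continuous (fun y : 'I_n -> R => 1 - y k ^+ 2).
  apply: row_continuousB; first exact: row_continuous_cst.
  by apply: row_continuousM; exact: row_continuous_coord.
apply: row_continuous_sum => j _; apply: row_continuousD; last exact: sq.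
apply: row_continuous_expR; apply: row_continuousD; first exact: row_continuous_cst.
apply: row_continuous_sum => i _; apply: row_continuous_sum => b _.
apply: row_continuousM; first exact: row_continuous_cst.
apply: row_continuous_expR; apply: row_continuousM; first exact: row_continuous_cst.
apply: row_continuousD; (apply: row_continuousM; first exact: row_continuous_cst).
  by apply: row_continuous_sum => k _; exact: sq.
exact: row_continuous_row_sum.
Qed.

Variables (N : {set I}) (B : I -> R).

Definition feasible (x y : 'I_n -> R) :=
  [/\ forall j, `|y j| <= 1, forall j, j \notin V -> y j = x j &
      {in N, forall i, `|row_sum inc y i| <= B i}].

Lemma exists_feasible_min x : feasible x x ->
  exists2 y, feasible x y & forall z, feasible x z -> pot y <= pot z.
Proof.
move=> fx.
pose F := (('I_n + I) * bool)%type.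
pose g (k : F) (y : 'I_n -> R) : R := (-1) ^+ k.2 * match k.1 with
  | inl j => if j \in V then 0 else y j
  | inr i => if i \in N then row_sum inc y i else 0 end.
pose c (k : F) : R := match k.1 with
  | inl j => if j \in V then 0 else (-1) ^+ k.2 * x j
  | inr i => if i \in N then B i else 0 end.
apply: (@exists_minimizer R n (feasible x) pot x F g c) => //.
- exact: row_continuous_potential.
- case=> -[j|i] b; (apply: row_continuousM; first exact: row_continuous_cst) => /=.
    by case: (j \in V); [exact: row_continuous_cst | exact: row_continuous_coord].
  by case: (i \in N); [exact: row_continuous_row_sum | exact: row_continuous_cst].
move=> y; split=> [[y1 yx yB]|[y1 yc]].
  split => // -[[j|i] b]; rewrite /g /c /=; case: ifP => iV; rewrite ?mulr0 //.
    by rewrite yx ?iV.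
  have := yB i iV; rewrite ler_norml => /andP[l u].
  by case: b; rewrite ?expr1 ?expr0 ?mulN1r ?mul1r // lerNl.
split => // [j /negbTE jV|i iN].
  have := yc (inl j, true); have := yc (inl j, false); rewrite /g /c /= jV.
  by rewrite !expr1 !expr0 !mulN1r !mul1r lerN2 => l u; apply/le_anti; rewrite l u.
have := yc (inr i, true); have := yc (inr i, false); rewrite /g /c /= iN.
by rewrite expr1 expr0 mulN1r mul1r ler_norml lerNl => -> ->.
Qed.

(** A minimiser of the potential under the constraints, if it had no frozen
    coordinate in V, could be moved a little both ways along the direction given
    by [exists_good_direction]: rows strictly inside their bounds tolerate a
    small move, and the direction does not move the other ones. *)
Lemma face_descent x :
  feasible x x -> (0 < #|V|)%N ->
  {in M, forall i, 0 < lam i} -> {in M, forall i, 0 < gam i} ->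
  {in M, forall i, 0 < e i} ->
  {in M, forall i, gam i <= 1 / 2} ->
  {in M, forall i, lam i <= gam i / 800} ->
  {in M, forall i, exists2 j, j \in V & inc i j} ->
  (forall y, feasible x y -> pot y <= pot x ->
     \sum_(i in M) lam i * danger inc lam gam e y i / gam i <= #|V|%:R / 16000 /\
     (#|[set i in N | (`|row_sum inc y i| == B i)%R]| * 10 <= #|V|)%N) ->
  exists y, [/\ feasible x y, pot y <= pot x & exists2 j, j \in V & `|y j| = 1].
Proof.
move=> fx V0 lam0 gam0 e0 gam2 lamgam alive small.
have [y fy ymin] := exists_feasible_min fx.
have yx : pot y <= pot x by exact: ymin.
exists y; split => //.
have [y1 yoff yB] := fy.
have [//|noface] := pselect (exists2 j, j \in V & `|y j| = 1).
have {}y1lt j : j \in V -> `|y j| < 1.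
  move=> jV; rewrite lt_neqAle y1 andbT; apply/eqP => yj.
  by apply: noface; exists j.
have [sumG ZV] := small y fy yx.
have [v [_ vV vZ curv]] := exists_good_direction off
  y1 lam0 gam0 e0 gam2 lamgam alive V0 sumG ZV.
have [t0 t0_gt0 t0P] := potential_drop
  (fun i iM => ltW (lam0 i iM)) (fun i iM => ltW (gam0 i iM))
  (fun i iM => ltW (e0 i iM)) curv.
pose free i := (i \in N) && (`|row_sum inc y i| < B i).
pose p (k : 'I_n + I) : R := match k with
  | inl j => if j \in V then `|y j| else 0
  | inr i => if free i then `|row_sum inc y i| else 0 end.
pose w (k : 'I_n + I) : R := match k with
  | inl j => `|v j| | inr i => `|row_sum inc v i| end.
pose b (k : 'I_n + I) : R := match k with
  | inl j => 1 | inr i => if free i then B i else 1 end.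
have pb k : p k < b k.
  case: k => [j|i] /=; first by case: ifP => // /y1lt.
  by case: ifP => // /andP[].
have [t1 t1_gt0 t1P] := exists_small_step w pb.
pose t := Num.min t0 t1.
have t_gt0 : 0 < t by rewrite lt_min t0_gt0.
have tt0 : 0 < t <= t0 by rewrite t_gt0 ge_min lexx.
have tt1 : 0 <= t <= t1 by rewrite ltW //= ge_min lexx orbT.
have stay (s : R) : `|s| = t -> feasible x (fun l => y l + s * v l).
  move=> st; split=> [j|j jV|i iN].
  - have [jV|jV] := boolP (j \in V); last by rewrite vV // mulr0 addr0.
    apply: le_trans (ler_normD _ _) _; rewrite normrM st.
    by have := t1P t (inl j) tt1; rewrite /= jV.
  - by rewrite vV // mulr0 addr0 yoff.
  have -> : row_sum inc (fun l => y l + s * v l) i = row_sum inc y i + s * row_sum inc v i.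
    by rewrite /row_sum mulr_sumr -big_split.
  have [fi|] := boolP (free i).
    apply: le_trans (ler_normD _ _) _; rewrite normrM st.
    by have := t1P t (inr i) tt1; rewrite /= fi.
  rewrite /free iN /= lt_neqAle yB // andbT negbK => yBi.
  by rewrite vZ ?mulr0 ?addr0 ?yB // inE iN.
have := t0P t tt0.
have := ymin _ (stay t (gtr0_norm t_gt0)).
have := ymin _ (stay (- t) _); rewrite normrN gtr0_norm // => /(_ erefl).
rewrite /pot; lra.
Qed.

End Face.

(** * Barriers and dangers of the levels *)

Section Levels.
Variables (R : realType) (s mu a b kappa : R).

(** Level k concerns rows of alive size about s / 2^k.  The gap [level_step] is
    the sum of a constant a, of order sqrt (log T), and of a multiple of
    sqrt (s / 2^k), of order the standard deviation of such a row. *)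
Definition contraction : R := Num.sqrt (1 / 2).
Definition level_size (k : nat) : R := s / 2 ^+ k.
Definition level_step (k : nat) : R := a + b * contraction ^+ k.
(** A closed form dominating the partial sums of [level_step]: the factor 8 - 3 w^k
    grows by 3 (w^k - w^(k+1)), at least w^(k+1) because w <= 3 / 4. *)
Definition level_bound (k : nat) : R :=
  (k + 5)%:R * a + b * (8 - 3 * contraction ^+ k).
Definition level_rate (k : nat) : R := (level_step k)^-1.
(** With this normalisation the slack term of the exponent never exceeds 1 / 40
    for a row of the level, a negligible part of the gap. *)
Definition level_pull (k : nat) : R := level_step k / (40 * level_size k).
Definition level_coef (k : nat) : R :=
  mu * 2 ^+ k * expR (- (level_rate k * level_bound k)).
Definition level_danger (k : nat) (y r : R) : R :=
  level_coef k * (expR (level_rate k * (level_pull k * r + y)) +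
                  expR (level_rate k * (level_pull k * r - y))).

Hypotheses (s_gt0 : 0 < s) (mu_gt0 : 0 < mu) (a_gt0 : 0 < a) (b_gt0 : 0 < b).
Hypotheses (kappa_gt0 : 0 < kappa) (b2 : b ^+ 2 = kappa * s).

Let w := contraction.

Let w_gt0 : 0 < w. Proof. by rewrite sqrtr_gt0. Qed.

Let w2 : w ^+ 2 = 1 / 2. Proof. by rewrite sqr_sqrtr. Qed.

Let w_bounds : 2 / 3 <= w <= 3 / 4.
Proof. by apply/andP; split; have := w_gt0; have := w2; nra. Qed.

Let wk_gt0 k : 0 < w ^+ k. Proof. exact: exprn_gt0. Qed.

Let wk2 k : (w ^+ k) ^+ 2 = (2 ^+ k)^-1.
Proof. by rewrite exprAC w2 div1r exprVn. Qed.

Let bwk2 k : (b * w ^+ k) ^+ 2 = kappa * level_size k.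
Proof. by rewrite exprMn wk2 b2 /level_size !mulrA. Qed.

Let bwk_gt0 k : 0 < b * w ^+ k. Proof. by rewrite mulr_gt0. Qed.

Lemma level_size_gt0 k : 0 < level_size k.
Proof. by rewrite divr_gt0 ?exprn_gt0. Qed.

Lemma level_step_gt0 k : 0 < level_step k.
Proof. by rewrite addr_gt0 ?bwk_gt0. Qed.

Lemma level_rate_gt0 k : 0 < level_rate k.
Proof. by rewrite invr_gt0 level_step_gt0. Qed.

Lemma level_pull_gt0 k : 0 < level_pull k.
Proof. by rewrite divr_gt0 ?level_step_gt0 // mulr_gt0 ?level_size_gt0. Qed.

Lemma level_coef_gt0 k : 0 < level_coef k.
Proof. by rewrite !mulr_gt0 ?expR_gt0 ?exprn_gt0. Qed.

Lemma level_danger_ge0 k y r : 0 <= level_danger k y r.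
Proof. by rewrite mulr_ge0 ?addr_ge0 ?expR_ge0 // ltW ?level_coef_gt0. Qed.

Lemma level_size_mono k k' : (k <= k')%N -> level_size k' <= level_size k.
Proof.
move=> kk'; rewrite ler_pM2l // lef_pV2 ?posrE ?exprn_gt0 //.
by rewrite ler_weXn2l // ler1n.
Qed.

Lemma sqr_le_level_step k : a ^+ 2 <= level_step k ^+ 2.
Proof. by rewrite lerXn2r ?nnegrE ?(ltW a_gt0) ?(ltW (level_step_gt0 k)) // lerDl ltW. Qed.

Lemma size_le_level_step k : kappa * level_size k <= level_step k ^+ 2.
Proof.
rewrite -bwk2 lerXn2r ?nnegrE ?(ltW (bwk_gt0 k)) ?(ltW (level_step_gt0 k)) //.
by rewrite lerDr ltW.
Qed.

Lemma level_rate_pull k : level_rate k <= level_pull k * (40 / kappa).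
Proof.
have := size_le_level_step k; have := level_step_gt0 k.
rewrite /level_rate /level_pull; have := level_size_gt0 k.
move: (level_step k) (level_size k) => x y y0 x0 le.
have -> : x / (40 * y) * (40 / kappa) = x ^+ 2 / (kappa * y) / x.
  by field; rewrite !gt_eqF.
rewrite -[leLHS]mul1r ler_pM2r ?invr_gt0 // ler_pdivlMr ?mul1r //.
by rewrite mulr_gt0.
Qed.

Lemma level_pull_le_half k :
  a <= 10 * level_size k -> kappa <= 100 * level_size k -> level_pull k <= 1 / 2.
Proof.
move=> ak sk; have s0 := level_size_gt0 k.
rewrite /level_pull ler_pdivrMr ?mulr_gt0 ?ltr0n //.
suff : b * w ^+ k <= 10 * level_size k by rewrite /level_step -/w; move: ak; lra.
rewrite -(ler_pXn2r (_ : (0 < 2)%N)) ?nnegrE ?(ltW (bwk_gt0 k)) //; last first.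
  by rewrite mulr_ge0 ?ler0n ?(ltW s0).
by rewrite bwk2 exprMn; have := ler_wpM2r (ltW s0) sk; lra.
Qed.

Lemma level_step_le k : level_step k.+1 <= level_step k.
Proof.
rewrite lerD2l ler_pM2l // exprS ler_piMl ?(ltW (wk_gt0 k)) //.
by rewrite -/w; move: w_bounds; lra.
Qed.

Lemma level_bound_succ k : level_bound k + level_step k.+1 <= level_bound k.+1.
Proof.
rewrite /level_bound /level_step addSn -(natr1 (k + 5)) exprS -/w.
have : 0 <= b * w ^+ k * (3 - 4 * w).
  by rewrite mulr_ge0 ?(ltW (bwk_gt0 k)) //; move: w_bounds; lra.
move: (w ^+ k) ((k + 5)%:R) => x y; lra.
Qed.

Lemma level_bound0 : level_bound 0 = 5 * level_step 0.
Proof. by rewrite /level_bound /level_step !expr0; ring. Qed.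

Lemma level_bound_mono k k' : (k <= k')%N -> level_bound k <= level_bound k'.
Proof.
move=> /subnK <-; elim: (k' - k)%N => [|i IH] //.
rewrite addSn; apply: le_trans IH (le_trans _ (level_bound_succ _)).
by rewrite lerDl ltW ?level_step_gt0.
Qed.

Lemma level_bound_ge0 k : 0 <= level_bound k.
Proof.
apply: le_trans (level_bound_mono (leq0n k)).
by rewrite level_bound0 mulr_ge0 ?ler0n ?(ltW (level_step_gt0 0)).
Qed.

Lemma level_bound_le k : level_bound k <= (k + 5)%:R * a + 8 * b.
Proof. by rewrite lerD2l -/w; have := bwk_gt0 k; lra. Qed.

Lemma level_danger_split k y r : level_danger k y r =
  mu * 2 ^+ k * (expR (level_rate k * (level_pull k * r + y - level_bound k)) +
                  expR (level_rate k * (level_pull k * r - y - level_bound k))).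
Proof.
rewrite /level_danger /level_coef -mulrA; congr (_ * _).
rewrite mulrDr -!expRD; congr (expR _ + expR _); ring.
Qed.

Lemma rate_pull_size k r : 0 <= r <= level_size k ->
  0 <= level_rate k * (level_pull k * r) <= 1 / 40.
Proof.
move=> /andP[r0 rs]; have s0 := level_size_gt0 k; have a0 := level_step_gt0 k.
have -> : level_rate k * (level_pull k * r) = r / level_size k / 40.
  by rewrite /level_rate /level_pull; field; rewrite !gt_eqF.
rewrite ler_pM2r ?invr_gt0 // ler_pdivrMr // mul1r rs andbT.
by rewrite !divr_ge0 // ltW.
Qed.

(** In units of the rate the gap is 1, of which at most 1 / 40 is lost to the
    slack term; the remaining factor exp (- 39 / 40) beats the doubling of the
    weight.  The rate itself increases, which is harmless below the barrier. *)
Lemma level_danger_succ k y r : `|y| <= level_bound k ->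
  0 <= r <= level_size k.+1 -> level_danger k.+1 y r <= level_danger k y r.
Proof.
rewrite ler_norml => /andP[y1 y2] rs.
suff half z : z <= level_bound k ->
    2 * expR (level_rate k.+1 * (level_pull k.+1 * r + z - level_bound k.+1)) <=
    expR (level_rate k * (level_pull k * r + z - level_bound k)).
  rewrite !level_danger_split.
  have c0 : 0 <= mu * 2 ^+ k by rewrite mulr_ge0 ?exprn_ge0 // ltW.
  rewrite [leLHS](_ : _ = mu * 2 ^+ k *
    (2 * (expR (level_rate k.+1 * (level_pull k.+1 * r + y - level_bound k.+1)) +
     expR (level_rate k.+1 * (level_pull k.+1 * r - y - level_bound k.+1))))); last by rewrite exprS; ring.
  apply: ler_wpM2l => //; rewrite mulrDr; apply: lerD; apply: half => //.
  by rewrite lerNl.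
move=> zb.
have two : 2 * expR (- (39 / 40)) <= 1 :> R.
  rewrite expRN ler_pdivrMr ?expR_gt0 // mul1r.
  have -> : 39 / 40 = 39 / 80 + 39 / 80 :> R by field.
  by rewrite expRD; have := expR_ge1Dx (39 / 80 : R); nra.
have rs' := rate_pull_size rs.
have rs0 : 0 <= r <= level_size k.
  case/andP: rs => -> /= /le_trans; apply; exact: level_size_mono.
have rs0' := rate_pull_size rs0.
have rate : level_rate k <= level_rate k.+1.
  by rewrite lef_pV2 ?posrE ?level_step_gt0 // level_step_le.
have step : level_rate k.+1 * level_step k.+1 = 1.
  by rewrite mulVf // gt_eqF ?level_step_gt0.
apply: (@le_trans _ _ (2 * expR (- (39 / 40)) * expR (level_rate k * (z - level_bound k)))).
  rewrite -mulrA ler_pM2l // -expRD ler_expR.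
  have := level_bound_succ k => /(ler_wpM2l (ltW (level_rate_gt0 k.+1))).
  rewrite mulrDr step.
  have : level_rate k.+1 * (z - level_bound k) <= level_rate k * (z - level_bound k).
    by apply: ler_wnM2r => //; rewrite subr_le0.
  by move: rs' => /andP[_]; lra.
apply: (@le_trans _ _ (expR (level_rate k * (z - level_bound k)))).
  by rewrite ler_piMl ?expR_ge0.
by rewrite ler_expR; move: rs0' => /andP[]; lra.
Qed.

Lemma level_danger_mono k k' y r : (k <= k')%N -> `|y| <= level_bound k ->
  0 <= r <= level_size k' -> level_danger k' y r <= level_danger k y r.
Proof.
move=> /subnK <-; elim: (k' - k)%N => [|i IH] // yb rs.
rewrite addSn; apply: le_trans (level_danger_succ _ rs) (IH yb _).
  by apply: le_trans yb (level_bound_mono _); rewrite leq_addl.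
by case/andP: rs => -> /= /le_trans; apply; apply: level_size_mono; rewrite leqnSn.
Qed.

(** The first barrier is five gaps away from 0, and 2 exp (1 / 40 - 5) <= 1 / 6. *)
Lemma level_danger_start k r : 0 <= r <= level_size k ->
  level_danger k 0 r <= mu / 6.
Proof.
move=> rs; apply: le_trans (level_danger_mono (leq0n k) _ rs) _.
  by rewrite normr0 level_bound_ge0.
have rs0 : 0 <= r <= level_size 0.
  by case/andP: rs => -> /= /le_trans; apply; exact: level_size_mono.
have rp := rate_pull_size rs0.
rewrite level_danger_split expr0 mulr1 addr0 subr0 level_bound0.
have -> : level_rate 0 * (level_pull 0 * r - 5 * level_step 0) =
    level_rate 0 * (level_pull 0 * r) - 5.
  by rewrite mulrBr /level_rate (mulrCA _ 5) mulVf ?mulr1 // gt_eqF ?level_step_gt0.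
set z := expR _.
have z16 : z * 16 <= 1.
  apply: (@le_trans _ _ (expR (- 4) * expR 1 ^+ 4)).
    apply: ler_pM => //; first exact: expR_ge0.
      by rewrite ler_expR; move: rp => /andP[_]; lra.
    have e2 : 2 <= expR 1 :> R by have := expR_ge1Dx (1 : R); lra.
    have -> : 16 = 2 ^+ 4 :> R by rewrite -natrX.
    by rewrite lerXn2r ?nnegrE ?expR_ge0.
  by rewrite -expRM_natl -expRD mulr1 addNr expR0.
have z0 : 0 <= z by exact: expR_ge0.
move: z z16 z0 => z z16 z0.
have := ler_wpM2l (ltW mu_gt0) z16; have := mu_gt0; nra.
Qed.

Lemma level_danger_full k y r : `|y| = level_bound k -> 0 <= r ->
  mu * 2 ^+ k <= level_danger k y r.
Proof.
move=> yb r0; rewrite level_danger_split; apply: ler_peMr.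
  by rewrite mulr_ge0 ?exprn_ge0 // ltW.
have pr : 0 <= level_rate k * (level_pull k * r).
  exact: mulr_ge0 (ltW (level_rate_gt0 k)) (mulr_ge0 (ltW (level_pull_gt0 k)) r0).
have [y0|y0] := leP 0 y.
  rewrite -yb ger0_norm // -[1 in leLHS]addr0; apply: lerD; last exact: expR_ge0.
  by rewrite -expR0 ler_expR addrK.
rewrite -yb ltr0_norm // -[1 in leLHS]add0r; apply: lerD; first exact: expR_ge0.
by rewrite -expR0 ler_expR opprK subrK.
Qed.

End Levels.

(** * Rounds of the colouring *)

Lemma twentieth_add (p q r m : nat) :
  (q * 20 <= m)%N -> (r * 20 <= m)%N -> (p <= q + r)%N -> (p * 10 <= m)%N.
Proof. lia. Qed.

Section Coloring.
Variables (R : realType) (I : finType) (n : nat) (inc : I -> 'I_n -> bool).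
Variables (d : nat) (L a b kappa bmax : R).

Let s : R := 20 * d%:R.
Let mu : R := 6 * L / d%:R.
Let sd : R := Num.sqrt d%:R.

Definition alive_size (V : {set 'I_n}) (i : I) : nat := #|[set j in V | inc i j]|.
Definition big_row V i := (20 * d < alive_size V i)%N.
Definition tiny_row V i := (alive_size V i ^ 2 <= d)%N.
Definition mid_rows V := [set i | ~~ tiny_row V i && ~~ big_row V i].
Definition row_level V i := trunc_log 2 (20 * d %/ alive_size V i).
Definition row_cap V i : R :=
  if big_row V i then 0 else level_bound a b (row_level V i).
(** Rows with many alive entries are charged beforehand a bound for the danger
    that they have on entering a level with sum 0, so that loads never increase. *)
Definition row_load V (x : 'I_n -> R) i : R :=
  if tiny_row V i then 0 else if big_row V i then L / d%:R else
  level_danger s mu a b (row_level V i) (row_sum inc x i) (slack inc x i).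
Definition big_load V j : R :=
  \sum_(i | inc i j && (~~ tiny_row V i && big_row V i)) L / d%:R.
Definition state_potential V (x : 'I_n -> R) : R :=
  potential inc V (mid_rows V) (fun i => level_rate a b (row_level V i))
    (fun i => level_pull s a b (row_level V i))
    (fun i => level_coef mu a b (row_level V i)) (big_load V) x.

Definition column_load V (x : 'I_n -> R) j : R := \sum_(i | inc i j) row_load V x i.

Lemma dangerE V x i :
  danger inc (fun i => level_rate a b (row_level V i))
    (fun i => level_pull s a b (row_level V i))
    (fun i => level_coef mu a b (row_level V i)) x i =
  level_danger s mu a b (row_level V i) (row_sum inc x i) (slack inc x i).
Proof.
rewrite /danger big_bool /= /tail /level_danger expr0 expr1 mul1r mulN1r addrC.
by rewrite -mulrDr.
Qed.

Lemma state_potentialE V x : state_potential V x = \sum_(j in V) (expR (column_load V x j) + (1 - x j ^+ 2)).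
Proof.
apply: eq_bigr => j _; congr (expR _ + _); rewrite /load /column_load /big_load.
rewrite [X in X + _]big_mkcond [X in _ + X]big_mkcond [RHS]big_mkcond -big_split /=.
apply: eq_bigr => i _; rewrite dangerE inE /row_load.
case: (inc i j); rewrite ?andbF ?addr0 //=.
by case: (tiny_row V i); case: (big_row V i); rewrite /= ?addr0 ?add0r.
Qed.

Hypothesis (d_gt0 : (0 < d)%N) (L_gt0 : 0 < L).

(** The level is the logarithm of an integer quotient, hence the factor 2 between
    the two bounds on the alive size. *)
Lemma mid_rowP V i : i \in mid_rows V ->
  [/\ (alive_size V i)%:R <= level_size s (row_level V i),
      level_size s (row_level V i) <= 2 * (alive_size V i)%:R,
      sd <= level_size s (row_level V i) & 2 ^+ row_level V i <= 20 * sd].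
Proof.
rewrite inE /tiny_row /big_row -!ltnNge ltnS /row_level; set z := alive_size V i.
move=> /andP[dz zd].
have z0 : (0 < z)%N by case: z dz {zd}.
have q0 : (0 < 20 * d %/ z)%N by rewrite divn_gt0.
have /= k1 := trunc_logP (isT : 1 < 2)%N q0.
have /= k2 := trunc_log_ltn (20 * d %/ z) (isT : 1 < 2)%N.
move: (trunc_log 2 _) k1 k2 => k; rewrite leq_divRL // ltn_divLR // => k1 k2.
have z0R : 0 < z%:R :> R by rewrite ltr0n.
have p0 : 0 < 2 ^+ k :> R by rewrite exprn_gt0.
have {}k1 : 2 ^+ k * z%:R <= 20 * d%:R :> R by rewrite -natrX -!natrM ler_nat.
have {}k2 : 20 * d%:R <= 2 ^+ k.+1 * z%:R :> R by rewrite -natrX -!natrM ler_nat ltnW.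
have {}dz : d%:R <= z%:R ^+ 2 :> R by rewrite -natrX ler_nat ltnW.
have sd2 : sd ^+ 2 = d%:R by rewrite sqr_sqrtr.
have sd0 : 0 < sd by rewrite sqrtr_gt0 ltr0n.
have sdz : sd <= z%:R.
  by rewrite -(ler_pXn2r (_ : (0 < 2)%N)) ?nnegrE ?ler0n ?(ltW sd0) // sd2.
have zs : z%:R <= level_size s k by rewrite /level_size ler_pdivlMr // mulrC.
split=> //.
- by rewrite /level_size ler_pdivrMr //; move: k2; rewrite exprS /s; lra.
- exact: le_trans zs.
rewrite -(ler_pM2r sd0) -mulrA -expr2 sd2; apply: le_trans k1.
by rewrite ler_pM2l.
Qed.

Lemma sum_alive (V : {set 'I_n}) (F : I -> R) :
  \sum_(j in V) \sum_(i | inc i j) F i = \sum_i (alive_size V i)%:R * F i.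
Proof.
rewrite (exchange_big_dep xpredT) //=; apply: eq_bigr => i _.
rewrite sumr_const mulr_natl; congr (_ *+ _).
by apply: eq_card => j; rewrite !inE.
Qed.

Hypotheses (a_gt0 : 0 < a) (b_gt0 : 0 < b) (kappa_gt0 : 0 < kappa).
Hypotheses (b2 : b ^+ 2 = kappa * s) (kappa_large : 40 / kappa <= 1 / 800).
Hypothesis a_large : 80 * (3 * L) / a ^+ 2 <= 1 / 16000.
Hypotheses (a_small : a <= 10 * sd) (kappa_small : kappa <= 100 * sd).
Hypothesis bmaxP : forall k, 2 ^+ k <= 20 * sd -> level_bound a b k <= bmax.
Hypothesis degree_le : forall j, (#|[set i | inc i j]| <= d)%N.

Let s_gt0 : 0 < s. Proof. by rewrite mulr_gt0 ?ltr0n. Qed.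
Let mu_gt0 : 0 < mu. Proof. by rewrite divr_gt0 ?mulr_gt0 ?ltr0n. Qed.

Lemma row_load_ge0 V x i : 0 <= row_load V x i.
Proof.
rewrite /row_load; case: ifP => // _; case: ifP => _.
  by rewrite divr_ge0 ?ler0n ?(ltW L_gt0).
exact: level_danger_ge0.
Qed.

(** The potential bounds every single exponential of a load. *)
Lemma column_load_le V x j : (forall j, `|x j| <= 1) -> state_potential V x <= expR (3 * L) ->
  j \in V -> column_load V x j <= 3 * L.
Proof.
move=> x1 phiL jV; rewrite -ler_expR; apply: le_trans phiL.
have x2 k : 0 <= 1 - x k ^+ 2 by rewrite subr_ge0 -(expr1n _ 2) sqr_le.
rewrite state_potentialE (bigD1 j) //= -addrA lerDl addr_ge0 // sumr_ge0 // => k _.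
by rewrite addr_ge0 ?expR_ge0.
Qed.

Lemma total_load_le V x : (forall j, `|x j| <= 1) -> state_potential V x <= expR (3 * L) ->
  \sum_i (alive_size V i)%:R * row_load V x i <= 3 * L * #|V|%:R.
Proof.
move=> x1 phiL; rewrite -sum_alive.
apply: (@le_trans _ _ (\sum_(j in V) 3 * L)).
  by apply: ler_sum => j jV; exact: column_load_le.
by rewrite sumr_const mulr_natr.
Qed.

(** The ratio of rate to pull is 40 [level_size] / [level_step]^2, at most
    80 times the alive size over a^2; the sum of alive sizes times dangers is the
    sum of the loads of alive columns. *)
Lemma level_ratio_sum_le V x : (forall j, `|x j| <= 1) -> state_potential V x <= expR (3 * L) ->
  \sum_(i in mid_rows V) level_rate a b (row_level V i) *
    level_danger s mu a b (row_level V i) (row_sum inc x i) (slack inc x i) /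
    level_pull s a b (row_level V i) <= #|V|%:R / 16000.
Proof.
move=> x1 phiL.
have a2 : 0 < a ^+ 2 by rewrite exprn_gt0.
apply: (@le_trans _ _ (\sum_i 80 / a ^+ 2 * ((alive_size V i)%:R * row_load V x i))).
  rewrite big_mkcond; apply: ler_sum => i _; case: ifP => iM; last first.
    by rewrite mulr_ge0 ?divr_ge0 ?ler0n ?(ltW a2) ?mulr_ge0 ?ler0n ?row_load_ge0.
  have [_ s2 _ _] := mid_rowP iM.
  move: iM; rewrite inE /row_load => /andP[/negbTE -> /negbTE ->].
  set k := row_level V i in s2 *; set G := level_danger _ _ _ _ _ _ _.
  have G0 : 0 <= G by exact: level_danger_ge0.
  have st := level_step_gt0 a_gt0 b_gt0 k; have sz := level_size_gt0 s_gt0 k.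
  have st2 := sqr_le_level_step a_gt0 b_gt0 k.
  have -> : level_rate a b k * G / level_pull s a b k =
      40 * level_size s k * G * (level_step a b k ^+ 2)^-1.
    by rewrite /level_rate /level_pull; field; rewrite !gt_eqF.
  have -> : 80 / a ^+ 2 * ((alive_size V i)%:R * G) =
      80 * (alive_size V i)%:R * G * (a ^+ 2)^-1 by field; rewrite gt_eqF.
  apply: ler_pM.
  - exact: mulr_ge0 (mulr_ge0 (ler0n _ _) (ltW sz)) G0.
  - by rewrite invr_ge0 sqr_ge0.
  - by apply: ler_wpM2r => //; move: s2; lra.
  - by rewrite lef_pV2 ?posrE ?exprn_gt0.
rewrite -mulr_sumr.
apply: (@le_trans _ _ (80 / a ^+ 2 * (3 * L * #|V|%:R))).
  by apply: ler_wpM2l (total_load_le x1 phiL); rewrite divr_ge0 ?ler0n ?(ltW a2).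
rewrite [leLHS](_ : _ = 80 * (3 * L) / a ^+ 2 * #|V|%:R); last by ring.
rewrite [leRHS](_ : _ = 1 / 16000 * #|V|%:R); last by rewrite div1r mulrC.
by apply: ler_wpM2r a_large; exact: ler0n.
Qed.

Lemma big_rows_le (V : {set 'I_n}) : (#|[set i | big_row V i]| * 20 <= #|V|)%N.
Proof.
have h : \sum_i (alive_size V i)%:R <= d%:R * #|V|%:R :> R.
  rewrite (eq_bigr (fun i => (alive_size V i)%:R * 1)) => [|i _]; last by rewrite mulr1.
  rewrite -sum_alive mulr_natr -sumr_const; apply: ler_sum => j _.
  rewrite sumr_const ler_nat; apply: leq_trans (degree_le j).
  by apply: eq_leq; apply: eq_card => i; rewrite inE.
rewrite -(leq_pmul2l d_gt0) -(ler_nat R) [leRHS]natrM; apply: le_trans h.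
rewrite (bigID (big_row V)) /= -[leLHS]addr0; apply: lerD; last exact: sumr_ge0.
rewrite mulnCA (mulnC d) natrM mulr_natl -sumr_const.
rewrite [leRHS](eq_bigl (mem [set i | big_row V i])) => [|i]; last by rewrite /= inE.
by apply: ler_sum => i; rewrite inE ler_nat; exact: ltnW.
Qed.

Lemma slack_ge0 (x : 'I_n -> R) i : (forall j, `|x j| <= 1) -> 0 <= slack inc x i.
Proof.
by move=> x1; apply: sumr_ge0 => k _; rewrite subr_ge0 -(expr1n _ 2) sqr_le.
Qed.

(** A row at its barrier has alive size times danger at least 60 L, for a total
    load of at most 3 L per alive column. *)
Lemma full_rows_le V x : (forall j, `|x j| <= 1) -> state_potential V x <= expR (3 * L) ->
  (#|[set i in mid_rows V | `|row_sum inc x i|%R == row_cap V i]| * 20 <= #|V|)%N.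
Proof.
move=> x1 phiL; set Z := [set _ in _ | _].
have h := total_load_le x1 phiL.
have L60 : 0 < 60 * L by rewrite mulr_gt0 ?ltr0n.
rewrite -(ler_nat R) natrM -(ler_pM2l L60).
suff : \sum_(i in Z) 60 * L <= 3 * L * #|V|%:R.
  by rewrite sumr_const -[_ *+ _]mulr_natr; lra.
apply: le_trans h; rewrite [leRHS](bigID (mem Z)) /= -[leLHS]addr0.
apply: lerD; last by apply: sumr_ge0 => i _; rewrite mulr_ge0 ?ler0n ?row_load_ge0.
apply: ler_sum => i; rewrite inE => /andP[iM /eqP].
have [_ s2 _ _] := mid_rowP iM.
move: iM; rewrite inE /row_load /row_cap => /andP[/negbTE -> /negbTE ->] yb.
have := level_danger_full s_gt0 mu_gt0 a_gt0 b_gt0 yb (slack_ge0 i x1).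
set k := row_level V i in s2 yb *; move/(ler_wpM2l (ler0n R (alive_size V i))) => le.
apply: le_trans le; rewrite mulrCA.
have p0 : 0 < 2 ^+ k :> R by rewrite exprn_gt0.
have : 10 * d%:R <= (alive_size V i)%:R * 2 ^+ k :> R.
  by move: s2; rewrite /level_size ler_pdivrMr // /s; lra.
move=> /(ler_wpM2l (ltW mu_gt0)) le; apply: le_trans le.
by apply: le_of_eq; rewrite /mu; field; rewrite gt_eqF ?ltr0n.
Qed.

Section Refine.
Variables (V V' : {set 'I_n}) (y : 'I_n -> R).
Hypotheses (V'V : V' \subset V) (y1 : forall j, `|y j| <= 1).
Hypothesis y_off : forall j, j \notin V' -> `|y j| = 1.
Hypothesis y_cap : forall i, ~~ tiny_row V i -> `|row_sum inc y i| <= row_cap V i.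

Lemma alive_size_mono i : (alive_size V' i <= alive_size V i)%N.
Proof.
apply/subset_leq_card/fintype.subsetP => j; rewrite !inE => /andP[jV' ->].
by rewrite (fintype.subsetP V'V).
Qed.

Lemma tiny_row_mono i : tiny_row V i -> tiny_row V' i.
Proof. by apply: leq_trans; rewrite leq_sqr alive_size_mono. Qed.

Lemma big_row_mono i : big_row V' i -> big_row V i.
Proof. by move=> /leq_trans; apply; exact: alive_size_mono. Qed.

Lemma row_level_mono i : ~~ tiny_row V' i -> (row_level V i <= row_level V' i)%N.
Proof.
move=> nt; apply: leq_trunc_log; apply: leq_div2l; last exact: alive_size_mono.
by rewrite lt0n; apply: contra nt; rewrite /tiny_row => /eqP ->.
Qed.

Lemma slack_le_alive i : slack inc y i <= (alive_size V' i)%:R.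
Proof.
rewrite /alive_size -sum1_card natr_sum /slack [leRHS]big_mkcond [leLHS]big_mkcond.
apply: ler_sum => j _; rewrite !inE; case: (inc i j); rewrite ?andbF ?andbT //.
case: ifP => [_|/negbT /y_off yj]; first by rewrite gerBl sqr_ge0.
by rewrite -(real_normK (num_real (y j))) yj expr1n subrr.
Qed.

(** Three changes of regime are possible when alive entries disappear: a row may
    enter a level from sum 0, move to a higher level, or become tiny. *)
Lemma row_load_mono i : row_load V' y i <= row_load V y i.
Proof.
rewrite {1}/row_load; have [|t'] := boolP (tiny_row V' i); first by rewrite row_load_ge0.
have t : ~~ tiny_row V i by apply: contra t' => /tiny_row_mono.
rewrite /row_load (negbTE t).
have [/big_row_mono -> //|nb'] := boolP (big_row V' i).
have iM : i \in mid_rows V' by rewrite inE t' nb'.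
have [s1 _ _ _] := mid_rowP iM.
have r : 0 <= slack inc y i <= level_size s (row_level V' i).
  by rewrite slack_ge0 //= (le_trans (slack_le_alive i)).
have := y_cap t; rewrite /row_cap; case: ifP => _ yc.
  have -> : row_sum inc y i = 0 by apply/normr0_eq0/le_anti; rewrite yc normr_ge0.
  apply: le_trans (level_danger_start s_gt0 mu_gt0 a_gt0 b_gt0 r) _.
  by apply: le_of_eq; rewrite /mu; field; rewrite gt_eqF ?ltr0n.
exact: level_danger_mono (row_level_mono t') yc r.
Qed.

Lemma state_potential_mono : state_potential V' y <= state_potential V y.
Proof.
rewrite !state_potentialE [leRHS](big_setID V') /= (finset.setIidPr V'V) -[leLHS]addr0.
apply: lerD; last first.
  apply: sumr_ge0 => j _; rewrite addr_ge0 ?expR_ge0 // subr_ge0.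
  by rewrite -(expr1n _ 2) sqr_le.
apply: ler_sum => j _; rewrite lerD2r ler_expR.
by apply: ler_sum => i _; exact: row_load_mono.
Qed.

Lemma row_cap_mono i : ~~ tiny_row V' i -> `|row_sum inc y i| <= row_cap V' i.
Proof.
move=> t'; have t : ~~ tiny_row V i by apply: contra t' => /tiny_row_mono.
have := y_cap t; rewrite /row_cap.
have [/big_row_mono -> //|_] := boolP (big_row V' i).
case: ifP => _ /le_trans; apply; first exact: level_bound_ge0.
by apply: level_bound_mono => //; exact: row_level_mono.
Qed.

End Refine.

Lemma bmax_ge0 : 0 <= bmax.
Proof.
apply: le_trans (level_bound_ge0 a_gt0 b_gt0 0) (bmaxP _).
rewrite expr0; apply: (@le_trans _ _ sd); last by rewrite ler_peMl ?sqrtr_ge0 // ler1n.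
by rewrite -sqrtr1 ler_sqrt ?ler1n ?ltr01 // ler0n.
Qed.

Lemma row_cap_le V i : ~~ tiny_row V i -> row_cap V i <= bmax.
Proof.
move=> t; rewrite /row_cap; case: ifP => [_|/negbT nb]; first exact: bmax_ge0.
have iM : i \in mid_rows V by rewrite inE t.
by apply: bmaxP; have [] := mid_rowP iM.
Qed.

(** For a tiny row the quantity that cannot increase is the absolute value of the
    frozen part plus the number of alive entries, not the sum of the row. *)
Definition frozen_sum (V : {set 'I_n}) (x : 'I_n -> R) i : R :=
  \sum_(j | inc i j && (j \notin V)) x j.

Definition good (V : {set 'I_n}) (x : 'I_n -> R) :=
  [/\ forall j, `|x j| <= 1,
      forall j, j \notin V -> `|x j| = 1,
      forall i, ~~ tiny_row V i -> `|row_sum inc x i| <= row_cap V i,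
      forall i, tiny_row V i -> `|frozen_sum V x i| + (alive_size V i)%:R <= bmax + 2 * sd &
      state_potential V x <= expR (3 * L)].

Lemma norm_sum_le_card (P : pred 'I_n) (x : 'I_n -> R) : (forall j, `|x j| <= 1) ->
  `|\sum_(j | P j) x j| <= #|P|%:R.
Proof.
move=> x1; apply: le_trans (ler_norm_sum _ _ _) _.
by rewrite -sum1_card natr_sum; apply: ler_sum.
Qed.

Lemma tiny_size_le V i : tiny_row V i -> (alive_size V i)%:R <= sd.
Proof.
move=> t; rewrite -(ler_pXn2r (_ : (0 < 2)%N)) ?nnegrE ?ler0n ?sqrtr_ge0 //.
by rewrite sqr_sqrtr ?ler0n // -natrX ler_nat.
Qed.

(** The numbers of rows that keep sum 0 and of rows at their barrier are each at most
    m / 20, as [face_descent] requires. *)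
Lemma good_step V x : good V x -> (0 < #|V|)%N ->
  exists (V' : {set 'I_n}) (y : 'I_n -> R), (#|V'| < #|V|)%N /\ good V' y.
Proof.
move=> [x1 x_off x_cap x_tiny phiL] V0.
pose N := [set i | ~~ tiny_row V i].
have fx : feasible inc V N (row_cap V) x x.
  by split => // i; rewrite inE; exact: x_cap.
have [y [fy yx [j0 j0V yj0]]] : exists y, [/\ feasible inc V N (row_cap V) x y,
    state_potential V y <= state_potential V x & exists2 j, j \in V & `|y j| = 1].
  apply: face_descent => //.
  - by move=> i _; exact: level_rate_gt0.
  - by move=> i _; exact: level_pull_gt0.
  - by move=> i _; exact: level_coef_gt0.
  - move=> i iM; have [_ _ sds _] := mid_rowP iM.
    apply: (level_pull_le_half s_gt0 b_gt0 b2).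
      by apply: le_trans a_small _; rewrite ler_pM2l ?ltr0n.
    by apply: le_trans kappa_small _; rewrite ler_pM2l ?ltr0n.
  - move=> i _; apply: le_trans (level_rate_pull s_gt0 a_gt0 b_gt0 kappa_gt0 b2 _) _.
    apply: le_trans (ler_wpM2l (ltW (level_pull_gt0 s_gt0 a_gt0 b_gt0 _)) kappa_large) _.
    by rewrite div1r.
  - move=> i; rewrite inE => /andP[nt _].
    have /card_gt0P[j] : (0 < #|[set j in V | inc i j]|)%N.
      by rewrite lt0n; apply: contra nt; rewrite /tiny_row /alive_size => /eqP ->.
    by rewrite inE => /andP[jV ij]; exists j.
  move=> y [y1 _ yc] yx; have yL : state_potential V y <= expR (3 * L) by apply: le_trans yx phiL.
  split.
    under eq_bigr do rewrite dangerE.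
    exact: level_ratio_sum_le.
  have := full_rows_le y1 yL; have := big_rows_le V.
  set Z1 := [set _ in _ | _]; set Z2 := [set _ | _]; set Z3 := [set _ in _ | _] => c1 c2.
  apply: (twentieth_add c1 c2).
  apply: leq_trans (leq_card_setU _ _); apply/subset_leq_card/fintype.subsetP => i.
  rewrite !inE => /andP[t yi]; rewrite t yi andbT.
  by case: (big_row V i).
have [y1 y_off yc] := fy.
pose V' := [set j in V | `|y j| != 1].
have V'V : V' \subset V by apply/fintype.subsetP => j; rewrite inE => /andP[].
have off' j : j \notin V' -> `|y j| = 1.
  rewrite inE negb_and negbK => /orP[jV|/eqP //].
  by rewrite y_off // x_off.
have cap i : ~~ tiny_row V i -> `|row_sum inc y i| <= row_cap V i.
  by move=> t; apply: yc; rewrite inE.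
exists V', y; split.
  apply: proper_card; apply/properP; split => //; exists j0 => //.
  by rewrite inE yj0 eqxx andbF.
split => //.
- by move=> i t'; apply: (row_cap_mono V'V).
- move=> i t'.
  have [t|t] := boolP (tiny_row V i).
    apply: le_trans (x_tiny i t).
    have -> : frozen_sum V' y i =
        frozen_sum V x i + \sum_(j | [&& inc i j, j \in V & j \notin V']) y j.
      rewrite /frozen_sum (bigID (mem V)) /= addrC; congr (_ + _).
        rewrite [RHS](eq_bigr y) => [|j /andP[_ jV]]; last by rewrite y_off.
        apply: eq_bigl => j; rewrite -andbA; congr (_ && _).
        have [jV|jV] := boolP (j \in V); rewrite ?andbF ?andbT //.
        by apply: contra jV => /(fintype.subsetP V'V).
      by apply: eq_bigl => j; rewrite -andbA; congr (_ && _); rewrite andbC.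
    have cE : (#|[pred j | [&& inc i j, j \in V & j \notin V']]| + alive_size V' i =
        alive_size V i)%N.
      rewrite /alive_size -(cardsID V' [set j in V | inc i j]) addnC; congr (_ + _)%N.
        apply: eq_card => j; rewrite !inE; case: (inc i j); rewrite ?andbF ?andbT //.
        by case: (j \in V).
      by apply: eq_card => j; rewrite !inE; case: (inc i j); case: (j \in V) => //=; rewrite ?andbF ?andbT.
    rewrite -cE natrD addrA lerD2r; apply: le_trans (ler_normD _ _) _.
    by rewrite lerD2l; exact: norm_sum_le_card.
  have -> : frozen_sum V' y i = row_sum inc y i - \sum_(j | inc i j && (j \in V')) y j.
    by rewrite /row_sum (bigID (mem V')) /= addrAC subrr add0r.
  apply: (@le_trans _ _ (bmax + sd + sd)); last by rewrite mulr_natl mulr2n addrA.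
  apply: lerD; last exact: tiny_size_le.
  apply: le_trans (ler_normB _ _) _; apply: lerD.
    by apply: le_trans (cap i t) (row_cap_le t).
  apply: le_trans (norm_sum_le_card _ y1) (le_trans _ (tiny_size_le t')).
  rewrite ler_nat; apply: eq_leq; apply: eq_card => j.
  by rewrite [LHS]unfold_in [RHS]inE andbC.
apply: le_trans (state_potential_mono V'V y1 off' cap) (le_trans yx phiL).
Qed.

Lemma good_start : n%:R <= expR L -> 2 <= expR L -> good [set: 'I_n] (fun=> 0).
Proof.
move=> nL L2.
have row0 i : row_sum inc (fun=> 0 : R) i = 0 by rewrite /row_sum big1_eq.
have sl i : slack inc (fun=> 0 : R) i = (alive_size [set: 'I_n] i)%:R.
  rewrite /slack /alive_size -sum1_card natr_sum; apply: eq_big => j.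
    by rewrite !inE.
  by rewrite expr0n subr0.
split => [j|j|i t|i t|].
- by rewrite normr0 ler01.
- by rewrite inE.
- by rewrite row0 normr0 /row_cap; case: ifP => // _; exact: level_bound_ge0.
- rewrite /frozen_sum big1 // normr0 add0r; apply: le_trans (tiny_size_le t) _.
  have : 0 <= sd by exact: sqrtr_ge0.
  have := bmax_ge0; lra.
have ld : L = L / d%:R * d%:R by rewrite divfK // gt_eqF ?ltr0n.
have rl i : row_load [set: 'I_n] (fun=> 0) i <= L / d%:R.
  rewrite /row_load; case: ifP => [_|/negbT t]; first by rewrite divr_ge0 ?ler0n ?(ltW L_gt0).
  case: ifP => // /negbT nb.
  have iM : i \in mid_rows [set: 'I_n] by rewrite inE t.
  have [s1 _ _ _] := mid_rowP iM.
  rewrite row0; apply: le_trans (level_danger_start s_gt0 mu_gt0 a_gt0 b_gt0 _) _.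
    by rewrite sl ler0n.
  by apply: le_of_eq; rewrite /mu; field; rewrite gt_eqF ?ltr0n.
have load j : column_load [set: 'I_n] (fun=> 0) j <= L.
  rewrite [leRHS]ld; apply: (@le_trans _ _ (\sum_(i | inc i j) L / d%:R)).
    by apply: ler_sum => i _; exact: rl.
  rewrite sumr_const -[leLHS]mulr_natr.
  apply: ler_wpM2l; first by rewrite divr_ge0 ?ler0n ?(ltW L_gt0).
  rewrite ler_nat; apply: leq_trans (degree_le j); apply: eq_leq; apply: eq_card => i.
  by rewrite [RHS]inE.
rewrite state_potentialE; apply: (@le_trans _ _ (\sum_(j in [set: 'I_n]) (expR L + 1))).
  apply: ler_sum => j _; rewrite expr0n subr0 lerD2r ler_expR; exact: load.
rewrite sumr_const cardsT card_ord -[leLHS]mulr_natr.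
have -> : 3 * L = L + L + L by ring.
rewrite !expRD mulrC -mulrA; have e0 := expR_gt0 L.
apply: ler_pM; [exact: ler0n | by rewrite addr_ge0 ?ler01 ?(ltW e0) | exact: nL |].
by move: L2; nra.
Qed.

Lemma exists_coloring : n%:R <= expR L -> 2 <= expR L ->
  exists2 x : 'I_n -> R, forall j, `|x j| = 1 &
    forall i, `|row_sum inc x i| <= bmax + 2 * sd.
Proof.
move=> nL L2; suff [x [x1 x_off _ x_tiny _]] : exists x, good finset.set0 x.
  exists x => [j|i]; first by apply: x_off; rewrite inE.
  have z0 : alive_size finset.set0 i = 0%N by apply: eq_card0 => j; rewrite !inE.
  have := x_tiny i; rewrite /tiny_row z0 => /(_ isT); rewrite addr0.
  rewrite /frozen_sum /row_sum (eq_bigl (inc i)) // => j.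
  by rewrite inE andbT.
have : exists x, good [set: 'I_n] x by exists (fun=> 0); exact: good_start.
move: [set: 'I_n] => V; move: {2}#|V|.+1 (ltnSn #|V|) => m.
elim: m V => [V V0 _|m IH V ltVm [x gx]].
  by exfalso; rewrite ltn0 in V0.
have [V0|V0] := posnP #|V|; first by exists x; move: gx; rewrite (cards0_eq V0).
have [V' [y [ltV gy]]] := good_step gx V0.
apply: (IH V'); last by exists y.
exact: leq_trans ltV ltVm.
Qed.

End Coloring.

(** * Choice of the constants *)

(** The map x |-> x / (ln x)^2 increases from exp 2 on; two cases avoid its study.  If x <= L^3
    then ln x <= 3 ln L, and otherwise L <= x^(1/3) while ln x <= 3 x^(1/3). *)
Lemma ln_sqr_le {R : realType} (L x : R) : 0 < L -> 1 <= x ->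
  L * ln L ^+ 2 <= x -> L * ln x ^+ 2 <= 9 * x.
Proof.
move=> L0 x1 Lx; have x0 : 0 < x by apply: lt_le_trans x1.
have lnx0 : 0 <= ln x by exact: ln_ge0.
have [xL|Lx3] := leP (ln x) (3 * ln L).
  apply: (@le_trans _ _ (9 * (L * ln L ^+ 2))); last by rewrite ler_pM2l.
  rewrite [leRHS]mulrCA ler_pM2l //.
  have -> : 9 * ln L ^+ 2 = (3 * ln L) ^+ 2 by ring.
  by rewrite sqr_le // ger0_norm.
set u := ln x / 3; have xE : x = expR u ^+ 3.
  by rewrite -expRM_natl /u mulrC divfK ?pnatr_eq0 // lnK.
have Lu : L <= expR u.
  by rewrite -[leLHS]lnK // ler_expR /u ler_pdivlMr // mulrC ltW.
have uu : u <= expR u by apply: le_trans (expR_ge1Dx u); rewrite lerDr.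
have u0 : 0 <= u by rewrite divr_ge0.
have -> : ln x = 3 * u by rewrite /u mulrC divfK // pnatr_eq0.
rewrite xE exprMn [leLHS]mulrCA (_ : 3 ^+ 2 = 9); last by rewrite -natrX.
rewrite ler_pM2l // [leRHS]exprS; apply: ler_pM => //; first exact: ltW.
- exact: sqr_ge0.
- by rewrite lerXn2r ?nnegrE ?expR_ge0.
Qed.

Lemma expn2_le_ln {R : realType} (k : nat) (x : R) :
  0 < x -> 2 ^+ k <= x -> k%:R <= 2 * ln x.
Proof.
move=> x0 kx; have e2 : expR (1 / 2) <= 2 :> R.
  apply: le_trans (expR_le_quadratic _) _; last lra.
  by rewrite ger0_norm ?lexx ?divr_ge0.
suff : k%:R * (1 / 2) <= ln x by lra.
rewrite -ler_expR lnK // expRM_natl; apply: le_trans kx.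
by rewrite lerXn2r ?nnegrE ?expR_ge0.
Qed.

Lemma disc_le {R : realType} (n T : nat) (A : 'M[R]_(n, T)) (x : 'I_T -> R) (c : R) :
  (forall i j, A i j = 0 \/ A i j = 1) -> (forall j, `|x j| = 1) -> 0 <= c ->
  (forall i, `|row_sum (fun i j => A i j != 0) x i| <= c) -> disc A <= c.
Proof.
move=> A01 x1 c0 xc; rewrite /disc.
apply: le_trans (bigmin_le _ [ffun j => x j == -1] _) _.
rewrite [leLHS]mx_normrE; apply: bigmax_le => // -[i k] _ /=; rewrite mxE.
apply: le_trans (xc i); rewrite /row_sum; apply: le_of_eq.
congr `|_|; rewrite [RHS]big_mkcond; apply: eq_bigr => j _; rewrite mxE ffunE.
have -> : (-1) ^+ (x j == -1) = x j.
  have [->|xN] := eqVneq (x j) (-1); first by rewrite expr1.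
  by have := x1 j => /eqP; rewrite eqr_norml (negbTE xN) orbF => /andP[/eqP -> _].
by case: (A01 i j) => ->; rewrite ?eqxx ?mul0r // oner_eq0 mul1r.
Qed.

Lemma bound_budget {R : realFieldType} (D l u : R) :
  l * u <= 3 * D -> 200 * l <= D -> 0 < D ->
  (2 * u + 5) * (2000 * l) + 8 * (800 * D) + 2 * D <= 20 * 1000 * D.
Proof. lra. Qed.

Lemma load_budget {R : realFieldType} (L : R) :
  0 < L -> 80 * (3 * L) / (2000 ^+ 2 * L) <= 1 / 16000.
Proof.
move=> L0; rewrite ler_pdivrMr; last by rewrite mulr_gt0 ?exprn_gt0 ?ltr0n.
rewrite expr2; lra.
Qed.

Lemma step_budget {R : realFieldType} (D l : R) : 200 * l <= D -> 2000 * l <= 10 * D.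
Proof. lra. Qed.

Lemma expR_ge2 {R : realType} (L : R) : 4 <= L -> 2 <= expR L.
Proof. by have := expR_ge1Dx L; lra. Qed.

Lemma kappa_budget {R : realFieldType} (D : R) : 400 <= D -> 40 * 800 <= 100 * D.
Proof. lra. Qed.

(** The level of a row is at most 2 ln d, so that the last barrier is
    O(sqrt L * ln d + sqrt d), which is O(sqrt d) by [ln_sqr_le]. *)
Lemma disc_le_sqrt_degree {R : realType} (n T d : nat) (A : 'M[R]_(n, T)) :
  (0 < T)%N -> 4 <= ln T%:R :> R ->
  200 ^+ 2 * ln T%:R <= d%:R :> R ->
  ln T%:R * ln (ln T%:R) ^+ 2 <= d%:R :> R ->
  (forall i j, A i j = 0 \/ A i j = 1) ->
  (forall j, (#|[set i | A i j != 0%R]| <= d)%N) ->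
  disc A <= 20 * 1000 * Num.sqrt d%:R.
Proof.
set L : R := ln T%:R => T0 L4 dL dLL A01 deg.
have L0 : 0 < L by apply: lt_le_trans L4; rewrite ltr0n.
have T0R : 0 < T%:R :> R by rewrite ltr0n.
have eL : expR L = T%:R by rewrite lnK.
have dR0 : 0 < d%:R :> R by apply: lt_le_trans dL; rewrite mulr_gt0 ?exprn_gt0 ?ltr0n.
have d0 : (0 < d)%N by rewrite -(ltr0n R).
set D : R := Num.sqrt d%:R; set l := Num.sqrt L.
have D0 : 0 < D by rewrite sqrtr_gt0.
have l0 : 0 < l by rewrite sqrtr_gt0.
have D2 : D ^+ 2 = d%:R by rewrite sqr_sqrtr ?(ltW dR0).
have l2 : l ^+ 2 = L by rewrite sqr_sqrtr ?(ltW L0).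
have lD : 200 * l <= D.
  rewrite -(ler_pXn2r (_ : (0 < 2)%N)) ?nnegrE ?mulr_ge0 ?ler0n ?(ltW l0) ?(ltW D0) //.
  by rewrite exprMn l2 D2.
have l_ge2 : 2 <= l.
  rewrite -(ler_pXn2r (_ : (0 < 2)%N)) ?nnegrE ?ler0n ?(ltW l0) // l2 -natrX.
  exact: L4.
have D400 : 400 <= D.
  by apply: le_trans lD; rewrite [leLHS](_ : _ = 200 * 2) ?ler_pM2l ?ltr0n // -natrM.
pose kappa : R := 40 * 800.
have kappa0 : 0 < kappa by rewrite mulr_gt0 ?ltr0n.
pose a := 2000 * l; pose b := 800 * D.
have a0 : 0 < a by rewrite mulr_gt0 ?ltr0n.
have b0 : 0 < b by rewrite mulr_gt0 ?ltr0n.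
pose bmax := (2 * ln d%:R + 5) * a + 8 * b.
have lnd : l * ln d%:R <= 3 * D.
  have d1 : 1 <= d%:R :> R by rewrite ler1n.
  have h : (l * ln d%:R) ^+ 2 <= 9 * D ^+ 2 by rewrite exprMn l2 D2; exact: ln_sqr_le.
  rewrite -(ler_pXn2r (_ : (0 < 2)%N)) ?nnegrE ?mulr_ge0 ?ler0n ?(ltW l0) ?(ltW D0) ?ln_ge0 //.
  by rewrite [leRHS]exprMn -natrX.
have bmax_le : bmax + 2 * D <= 20 * 1000 * D.
  by move: (lnd) (lD) (D0); rewrite /bmax /a /b; exact: bound_budget.
have bmaxP k : 2 ^+ k <= 20 * D -> level_bound a b k <= bmax.
  move=> kD; apply: le_trans (level_bound_le a b0 k) _; rewrite lerD2r.
  rewrite ler_pM2r // natrD lerD2r; apply: expn2_le_ln => //; apply: le_trans kD _.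
  rewrite -D2 expr2 ler_pM2r //; apply: le_trans D400; rewrite ler_nat //.
have [] := @exists_coloring R 'I_n T (fun i j => A i j != 0) d L a b kappa bmax
  d0 L0 a0 b0 kappa0.
- by rewrite /b /kappa exprMn D2; ring.
- by rewrite /kappa invfM mulVKf ?pnatr_eq0 // div1r.
- by rewrite /a exprMn l2; exact: load_budget.
- by rewrite /a; exact: step_budget.
- by rewrite /kappa -/D; exact: kappa_budget.
- exact: bmaxP.
- exact: deg.
- by rewrite eL.
- exact: expR_ge2.
move=> x x1 xc; apply: (disc_le A01 x1) => [|i]; first by rewrite !mulr_ge0 ?ler0n ?sqrtr_ge0.
exact: le_trans (xc i) bmax_le.
Qed.

Lemma product_le {R : realFieldType} (C L u d : R) :
  1 <= C -> 0 < L -> 1 <= u -> C * L * u <= d -> C * L <= d /\ L * u <= d.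
Proof.
move=> C1 L0 u1 le; have C0 : 0 <= C by apply: le_trans C1.
have u0 : 0 <= u by apply: le_trans u1.
split; apply: le_trans le; first by rewrite ler_peMr // mulr_ge0 // ltW.
by rewrite -mulrA ler_peMl // mulr_ge0 // ltW.
Qed.

Unset Implicit Arguments.

Theorem corollary1p2 (R : realType) (eta : R) (eta_gt0 : 0 < eta) :
  exists C C' T0 : R,
    [/\ 0 < C, 0 < C' & 0 < T0] /\
    forall n T d : nat, (0 < n)%N -> (0 < T)%N -> (0 < d)%N ->
      T0 <= T%:R ->
      C * ln T%:R * ln (ln T%:R) `^ (2 + eta) <= d%:R ->
      forall A : 'M[R]_(n, T),
        (forall i j, A i j = 0 \/ A i j = 1) ->
        (forall j, (#|[set i | A i j != 0%R]| <= d)%N) ->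
        disc A <= C' * Num.sqrt d%:R.
Proof.
exists (200 ^+ 2), (20 * 1000), (expR (expR 2)); split.
  split; [by rewrite exprn_gt0 ?ltr0n | by rewrite mulr_gt0 ?ltr0n |].
  exact: expR_gt0.
move=> n T d _ T_gt0 d_gt0 TT0 dC A A01 deg.
have T0R : 0 < T%:R :> R by rewrite ltr0n.
have L2 : expR 2 <= ln T%:R :> R by rewrite -ler_expR lnK.
have L4 : 4 <= ln T%:R :> R.
  apply: le_trans L2; have -> : 2 = 1 + 1 :> R by [].
  by rewrite expRD; have := expR_ge1Dx (1 : R); nra.
have L0 : 0 < ln T%:R :> R by apply: lt_le_trans L2; exact: expR_gt0.
have lL : 2 <= ln (ln T%:R) :> R by rewrite -ler_expR lnK.
have l1 : 1 <= ln (ln T%:R) :> R by apply: le_trans lL; rewrite ler1n.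
have pow : ln (ln T%:R) ^+ 2 <= ln (ln T%:R) `^ (2 + eta) :> R.
  rewrite -powR_mulrn ?(le_trans ler01 l1) //; apply: ler_powR => //.
  by rewrite lerDl ltW.
have C1 : 1 <= 200 ^+ 2 :> R by rewrite exprn_ege1 ?ler1n.
have := le_trans (ler_wpM2l _ pow) dC.
rewrite mulr_ge0 ?(le_trans ler01 C1) ?(ltW L0) // => /(_ isT) dL.
have [dL1 dL2] := product_le C1 L0 (exprn_ege1 2 l1) dL.
exact: disc_le_sqrt_degree T_gt0 L4 dL1 dL2 A01 deg.
Qed.
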